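(* Let $a,b\in\mathbb{R}^+\cup\{\infty\}$, $n\ge1$, and $\Lambda:=(-a,b)\times\mathbb{R}^n\times\mathbb{R}$ with points written $(U,X,V)$. Assume: (1) For $\varepsilon\in(0,1]$, $t_\varepsilon:\Lambda\to\Lambda$, $t_\varepsilon(U,X,V)=(U,\,x_\varepsilon(U,X),\,V+g_\varepsilon(U,X)+h_\varepsilon(U,X))$ with $x_\varepsilon\in C^\infty((-a,b)\times\mathbb{R}^n,\mathbb{R}^n)$ and $g_\varepsilon,h_\varepsilon\in C^\infty((-a,b)\times\mathbb{R}^n,\mathbb{R})$; $(t_\varepsilon)_\varepsilon$ has property (E); and $(h_\varepsilon)_\varepsilon$ is uniformly bounded on compact subsets of $(-a,b)\times\mathbb{R}^n$ (for small $\varepsilon$). (2) $s_\varepsilon:\Lambda\to\Lambda$, $s_\varepsilon(U,X,V)=(U,\,x_\varepsilon(U,X),\,V+g_\varepsilon(U,X))$, and $(s_\varepsilon)_\varepsilon$ has property (E). (3) $s:\Lambda\to\Lambda$, $s(U,X,V)=(U,\,x(U,X),\,V+g(U,X))$ with $x\in C((-a,b)\times\mathbb{R}^n,\mathbb{R}^n)$, $g\in C((-a,b)\times\mathbb{R}^n,\mathbb{R})$, and there is an open set $W\subseteq(-a,b)\times\mathbb{R}^n$ containing $(-a,0]\times\mathbb{R}^n$ such that $\hat s:=(U,x):(-a,b)\times\mathbb{R}^n\to(-a,b)\times\mathbb{R}^n$ is injective on $W$. (4) $s_\varepsilon\to s$ as $\varepsilon\to0$ uniformly on compact subsets of $\Lambda$.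 Then for every point $p\in\Lambda$ with $U$-coordinate $0$ there exist an open neighbourhood $P$ of $p$ with $P\subseteq W\times\mathbb{R}$, an open neighbourhood $Q$ of $q:=s(p)$ with $Q\subseteq s(W\times\mathbb{R})$, and $\varepsilon_0\in(0,1]$ such that $\overline Q\subseteq t_\varepsilon(P)$ for all $\varepsilon\le\varepsilon_0$.
   Context: Property (E): a net $(u_\varepsilon)_\varepsilon$ of smooth maps $(-a,b)\times\mathbb{R}^n\times\mathbb{R}\to(-a,b)\times\mathbb{R}^n\times\mathbb{R}$ has property (E) if for every compact $K\subseteq\mathbb{R}^n$ there exist $\alpha\in(0,b)$ and $\varepsilon_0\in(0,1]$ such that $u_\varepsilon$ is injective on $(-a,\alpha]\times K\times\mathbb{R}$ for all $\varepsilon\le\varepsilon_0$. *)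

(* Defs.v *)
From Stdlib Require Import Reals Lra List.
From Stdlib Require Fin.
Open Scope R_scope.

Definition Vec (n : nat) := Fin.t n -> R.
Definition Om (n : nat) := (R * Vec n)%type.
Definition Lam (n : nat) := (R * Vec n * R)%type.

(* Extended bounds: None stands for +infinity. *)
Definition ext_pos (a : option R) : Prop :=
  match a with Some a => 0 < a | None => True end.
Definition gt_lb (a : option R) (u : R) : Prop :=
  match a with Some a => - a < u | None => True end.
Definition lt_ub (b : option R) (u : R) : Prop :=
  match b with Some b => u < b | None => True end.
Definition inI (a b : option R) (u : R) : Prop := gt_lb a u /\ lt_ub b u.

Definition inOm {n} (a b : option R) (p : Om n) : Prop := inI a b (fst p).
Definition inLam {n} (a b : option R) (p : Lam n) : Prop := inI a b (fst (fst p)).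

(* Max-norm balls (inducing the standard product topologies). *)
Definition ballR (x : R) (r : R) (y : R) : Prop := Rabs (y - x) < r.
Definition ballV (n : nat) (x : Vec n) (r : R) (y : Vec n) : Prop :=
  forall i, Rabs (y i - x i) < r.
Definition ballO (n : nat) (p : Om n) (r : R) (q : Om n) : Prop :=
  ballR (fst p) r (fst q) /\ ballV n (snd p) r (snd q).
Definition ballL (n : nat) (p : Lam n) (r : R) (q : Lam n) : Prop :=
  ballO n (fst p) r (fst q) /\ ballR (snd p) r (snd q).

Section Topo.
Context {T : Type} (ball : T -> R -> T -> Prop).

Definition is_open (S : T -> Prop) : Prop :=
  forall x, S x -> exists r, 0 < r /\ forall y, ball x r y -> S y.

Definition clos (S : T -> Prop) (x : T) : Prop :=
  forall r, 0 < r -> exists y, S y /\ ball x r y.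

Definition is_compact (K : T -> Prop) : Prop :=
  forall (I : Type) (O : I -> T -> Prop),
    (forall i, is_open (O i)) ->
    (forall x, K x -> exists i, O i x) ->
    exists l : list I, forall x, K x -> exists i, List.In i l /\ O i x.
End Topo.

Definition continuous_on {T1 T2 : Type}
  (b1 : T1 -> R -> T1 -> Prop) (b2 : T2 -> R -> T2 -> Prop)
  (D : T1 -> Prop) (f : T1 -> T2) : Prop :=
  forall p, D p -> forall e, 0 < e ->
    exists d, 0 < d /\ forall q, D q -> b1 p d q -> b2 (f p) e (f q).

(* Partial derivatives on (-a,b) x R^n: direction None = U, Some i = X_i. *)
Definition shift {n} (p : Om n) (d : option (Fin.t n)) (h : R) : Om n :=
  match d with
  | None => (fst p + h, snd p)
  | Some i => (fst p, fun j => if Fin.eq_dec i j then snd p j + h else snd p j)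
  end.

Fixpoint Ck {n} (k : nat) (D : Om n -> Prop) (f : Om n -> R) : Prop :=
  match k with
  | O => continuous_on (ballO n) ballR D f
  | S k => continuous_on (ballO n) ballR D f /\
      forall d : option (Fin.t n), exists df : Om n -> R,
        (forall p, D p -> derivable_pt_lim (fun h => f (shift p d h)) 0 (df p)) /\
        Ck k D df
  end.

(* C^infinity on D (D open), real-valued and R^n-valued. *)
Definition smooth {n} (D : Om n -> Prop) (f : Om n -> R) : Prop :=
  forall k, Ck k D f.
Definition smoothV {n} (D : Om n -> Prop) (f : Om n -> Vec n) : Prop :=
  forall i, smooth D (fun p => f p i).

Definition propE (n : nat) (a b : option R) (u : R -> Lam n -> Lam n) : Prop :=
  forall K : Vec n -> Prop, is_compact (ballV n) K ->
    exists alpha, 0 < alpha /\ lt_ub b alpha /\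
    exists eps0, 0 < eps0 <= 1 /\
      forall eps, 0 < eps <= eps0 ->
        forall p q : Lam n,
          (gt_lb a (fst (fst p)) /\ fst (fst p) <= alpha /\ K (snd (fst p))) ->
          (gt_lb a (fst (fst q)) /\ fst (fst q) <= alpha /\ K (snd (fst q))) ->
          u eps p = u eps q -> p = q.

Definition tmap {n} (x : Om n -> Vec n) (g h : Om n -> R) (p : Lam n) : Lam n :=
  let '(U, X, V) := p in (U, x (U, X), V + g (U, X) + h (U, X)).
Definition smap {n} (x : Om n -> Vec n) (g : Om n -> R) (p : Lam n) : Lam n :=
  let '(U, X, V) := p in (U, x (U, X), V + g (U, X)).

(* Main.v *)
(** Slicewise in [U] the theorem is a statement about maps of [R^n]: an injective
    continuous [f] on a ball around [c] has some [mu > 0] such that every continuous [ft]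
    that is [mu]-close to [f] attains every value [mu]-close to [f c].  If [ft] omits such
    a value [y], then [ft - y], defined on the inner half of a cross-polytope, extends
    without zeros to a map that is odd on the boundary, through the differences
    [ft (c + u) - ft (c - t u)] with [u] and [- t u] at fixed distance; these stay away
    from zero because [f] is injective.  This contradicts the Borsuk-Ulam theorem, which
    follows from Tucker's lemma: Ky Fan's mod 2 cochain is evaluated on iterated barycentric
    subdivisions of the cross-polytope.  Chains enter only dually, through cochains
    [list T -> bool] on ordered simplices, so no triangulation is ever constructed.
    The [V]-direction is a translation by a bounded amount and only requires [P] to be
    tall enough. *)

Require Import Defs.
From Stdlib Require Import Reals Lra Lia List Bool.
From Stdlib Require Import FunctionalExtensionality Classical.
Import ListNotations.
Open Scope R_scope.

(** * Mod 2 cochains and Fan's cochain *)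

Section Cochains.
Context {T : Type}.
Implicit Types (f g : T -> bool) (phi psi : list T -> bool) (s t : list T).

(** The mod 2 sum, over the positions of [s], of [f] at that vertex times [phi] on the list with
    that vertex deleted. It is the product of a 0-cochain with a cochain, shuffled over all
    positions; for [f] constantly true it is the simplicial coboundary. *)
Fixpoint wedge f phi s : bool :=
  match s with
  | [] => false
  | x :: s => xorb (f x && phi s) (wedge f (fun t => phi (x :: t)) s)
  end.

Definition delta := wedge (fun _ => true).

Lemma wedge_ext f g phi psi s :
  (forall x, In x s -> f x = g x) ->
  (forall t, S (length t) = length s -> incl t s -> phi t = psi t) ->
  wedge f phi s = wedge g psi s.
Proof.
  revert phi psi; induction s as [|x s IH]; intros phi psi Hf Hphi; simpl; auto.
  rewrite (Hf x) by (simpl; auto).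
  rewrite (Hphi s) by (simpl; auto; apply incl_tl, incl_refl).
  rewrite (IH (fun t => phi (x :: t)) (fun t => psi (x :: t))); auto.
  - intros y Hy; apply Hf; simpl; auto.
  - intros t Ht Hi; apply Hphi; [simpl; congruence|].
    intros y [->|Hy]; simpl; auto.
Qed.

Lemma wedge_xor_form f g phi s :
  wedge (fun x => xorb (f x) (g x)) phi s = xorb (wedge f phi s) (wedge g phi s).
Proof.
  revert phi; induction s as [|x s IH]; intros phi; simpl; auto.
  rewrite IH. destruct (f x), (g x), (phi s), (wedge f _ s), (wedge g _ s); reflexivity.
Qed.

Lemma wedge_xor f phi psi s :
  wedge f (fun t => xorb (phi t) (psi t)) s = xorb (wedge f phi s) (wedge f psi s).
Proof.
  revert phi psi; induction s as [|x s IH]; intros phi psi; simpl; auto.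
  rewrite (IH (fun t => phi (x :: t))).
  destruct (f x), (phi s), (psi s), (wedge f _ s), (wedge f _ s); reflexivity.
Qed.

Lemma wedge_false f s : wedge f (fun _ => false) s = false.
Proof. induction s as [|x s IH]; simpl; auto. now rewrite andb_false_r. Qed.

Lemma wedge_false_form phi s : wedge (fun _ => false) phi s = false.
Proof. revert phi; induction s as [|x s IH]; intros phi; simpl; auto. Qed.

Lemma wedge_scal (b : bool) f phi s :
  wedge f (fun t => b && phi t) s = b && wedge f phi s.
Proof.
  destruct b; simpl.
  - apply wedge_ext; auto.
  - apply wedge_false.
Qed.

Lemma wedge_comm f g phi s :
  wedge f (wedge g phi) s = wedge g (wedge f phi) s.
Proof.
  revert phi; induction s as [|x s IH]; intros phi; simpl; auto.
  rewrite !wedge_xor, !wedge_scal, IH.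
  destruct (f x), (g x), (wedge f _ s), (wedge g _ s), (wedge _ _ s); reflexivity.
Qed.

(** The double sum runs over ordered pairs of distinct positions with a summand symmetric in the
    two, so every unordered pair is counted twice. *)
Lemma wedge_wedge f phi s : wedge f (wedge f phi) s = false.
Proof.
  revert phi; induction s as [|x s IH]; intros phi; simpl; auto.
  rewrite !wedge_xor, !wedge_scal, IH.
  destruct (f x), (wedge f _ s); reflexivity.
Qed.

Lemma wedge_form_vanish f phi s :
  (forall x, In x s -> f x = false) -> wedge f phi s = false.
Proof.
  intros H. rewrite (wedge_ext f (fun _ => false) phi phi); auto.
  apply wedge_false_form.
Qed.

Lemma wedge_vanish f phi s :
  (forall t, S (length t) = length s -> incl t s -> phi t = false) ->
  wedge f phi s = false.
Proof.
  intros H. rewrite (wedge_ext f f phi (fun _ => false)); auto.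
  apply wedge_false.
Qed.

(** As soon as one vertex of [s] satisfies [f], no vertex of [s] satisfies [g]. *)
Lemma wedge_disjoint f g phi s :
  (forall x y, In x s -> In y s -> f x && g y = false) ->
  wedge f (wedge g phi) s = false.
Proof.
  intros H. destruct (classic (exists x, In x s /\ f x = true)) as [[x [Hx Hf]]|Hn].
  - apply wedge_vanish. intros t _ Ht. apply wedge_form_vanish. intros y Hy.
    specialize (H x y Hx (Ht y Hy)). now rewrite Hf in H.
  - apply wedge_form_vanish. intros x Hx.
    destruct (f x) eqn:E; auto. exfalso; eauto.
Qed.

Lemma delta_delta phi s : delta (delta phi) s = false.
Proof. apply wedge_wedge. Qed.

Lemma wedge_map (U : T -> T) f phi s :
  wedge f phi (map U s) = wedge (fun x => f (U x)) (fun t => phi (map U t)) s.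
Proof.
  revert phi; induction s as [|x s IH]; intros phi; simpl; auto.
  now rewrite IH.
Qed.

(* Evaluating [phi] on the barycentric subdivision of the simplex [s], where the
   subdivision of [s] is the cone from [b s] over the subdivision of its boundary;
   [k] is the number of vertices of [s]. *)
Fixpoint sdk (b : list T -> T) (k : nat) phi s : bool :=
  match k with
  | O => phi s
  | S k => delta (sdk b k (fun t => phi (b s :: t))) s
  end.

Definition sd b phi s := sdk b (length s) phi s.

Lemma sd_unfold b phi s :
  s <> [] -> sd b phi s = delta (sd b (fun t => phi (b s :: t))) s.
Proof.
  intros Hs. unfold sd at 1. destruct s as [|x s]; [easy|].
  cbn [length sdk]. apply wedge_ext; auto.
  intros t Ht _. injection Ht as Ht. unfold sd. now rewrite Ht.
Qed.

Lemma sd_xor b phi psi s :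
  sd b (fun t => xorb (phi t) (psi t)) s = xorb (sd b phi s) (sd b psi s).
Proof.
  remember (length s) as k eqn:Hk. revert s phi psi Hk.
  induction k as [|k IH]; intros s phi psi Hk.
  - destruct s; [reflexivity|discriminate].
  - assert (Hs : s <> []) by (now destruct s).
    rewrite !(sd_unfold b _ s) by auto. unfold delta.
    rewrite <- wedge_xor. apply wedge_ext; auto.
    intros t Ht _. apply (IH t (fun t => phi (b s :: t)) (fun t => psi (b s :: t))). lia.
Qed.

(** Dual form of the fact that subdivision is a chain map. The boundary of a cone is its base plus
    the cone over the boundary of the base; the base gives the right-hand side, and the other part
    is a double coboundary by induction. *)
Lemma sd_delta b phi s : sd b (delta phi) s = delta (sd b phi) s.
Proof.
  remember (length s) as k eqn:Hk. revert s phi Hk.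
  induction k as [|k IH]; intros s phi Hk.
  - destruct s; [reflexivity|discriminate].
  - assert (Hs : s <> []) by (now destruct s).
    rewrite (sd_unfold b _ s) by auto.
    transitivity (delta (fun t => xorb (sd b phi t)
      (delta (sd b (fun u => phi (b s :: u))) t)) s).
    + apply wedge_ext; auto. intros t Ht _.
      rewrite <- IH by lia. rewrite <- sd_xor. reflexivity.
    + unfold delta at 1. rewrite wedge_xor.
      change (xorb (delta (sd b phi) s) (delta (delta (sd b (fun u => phi (b s :: u)))) s)
              = delta (sd b phi) s).
      now rewrite delta_delta, xorb_false_r.
Qed.

Lemma sd_map b (U : T -> T) phi s :
  (forall t, b (map U t) = U (b t)) ->
  sd b phi (map U s) = sd b (fun t => phi (map U t)) s.
Proof.
  intros HU. remember (length s) as k eqn:Hk. revert s phi Hk.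
  induction k as [|k IH]; intros s phi Hk.
  - destruct s; [reflexivity|discriminate].
  - rewrite !sd_unfold by (now destruct s).
    unfold delta. rewrite wedge_map. apply wedge_ext; auto.
    intros t Ht _. rewrite IH by lia. simpl. now rewrite HU.
Qed.

Fixpoint sdn (b : list T -> T) (m : nat) phi : list T -> bool :=
  match m with O => phi | S m => sd b (sdn b m phi) end.

Lemma sd_ext b phi psi s : (forall t, phi t = psi t) -> sd b phi s = sd b psi s.
Proof. intros H. now rewrite (functional_extensionality phi psi H). Qed.

Lemma sdn_xor b m phi psi s :
  sdn b m (fun t => xorb (phi t) (psi t)) s = xorb (sdn b m phi s) (sdn b m psi s).
Proof.
  revert s; induction m as [|m IH]; intros s; simpl; auto.
  rewrite <- sd_xor. now apply sd_ext.
Qed.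

Lemma sdn_delta b m phi s : sdn b m (delta phi) s = delta (sdn b m phi) s.
Proof.
  revert s; induction m as [|m IH]; intros s; simpl; auto.
  rewrite <- sd_delta. now apply sd_ext.
Qed.

Lemma sdn_map b m (U : T -> T) phi s :
  (forall t, b (map U t) = U (b t)) ->
  sdn b m phi (map U s) = sdn b m (fun t => phi (map U t)) s.
Proof.
  intros HU; revert s; induction m as [|m IH]; intros s; simpl; auto.
  rewrite sd_map by auto. now apply sd_ext.
Qed.

Lemma sdn_nil b m phi : sdn b m phi [] = phi [].
Proof. induction m as [|m IH]; simpl; auto. Qed.

(** * Labels, alternating simplices and the cross-polytope chain *)

Context {J : Type} (lab : J -> bool -> T -> bool).

(* Ky Fan's cochain: it counts the simplices whose labels, sorted by axis in the
   order of [L], carry alternating signs beginning with [e]. *)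
Fixpoint fan (e : bool) (L : list J) : list T -> bool :=
  match L with
  | [] => fun s => match s with [] => true | _ => false end
  | j :: L => fun s => xorb (fan e L s) (wedge (lab j e) (fan (negb e) L) s)
  end.

(** The parity of the number of labels that [x] carries, hence true when there is exactly one. *)
Fixpoint labelled (L : list J) (x : T) : bool :=
  match L with
  | [] => false
  | j :: L => xorb (xorb (lab j true x) (lab j false x)) (labelled L x)
  end.

Lemma fan_nil e L : fan e L [] = true.
Proof. revert e; induction L as [|j L IH]; intros e; simpl; auto. now rewrite IH. Qed.

(** Each axis of [L] accounts for at most one vertex. *)
Lemma fan_long e L s : (length L < length s)%nat -> fan e L s = false.
Proof.
  revert e s; induction L as [|j L IH]; intros e s Hs; simpl in *.
  - destruct s; simpl in *; auto; lia.
  - rewrite IH by lia. rewrite wedge_vanish; auto.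
    intros t Ht _. apply IH. lia.
Qed.

Lemma fan_flip (U : T -> T) e L s :
  (forall x j e, In x s -> lab j e (U x) = lab j (negb e) x) ->
  fan e L (map U s) = fan (negb e) L s.
Proof.
  revert e s; induction L as [|j L IH]; intros e s Hs; simpl.
  - now destruct s.
  - rewrite IH by auto. f_equal. rewrite wedge_map. apply wedge_ext; auto.
Qed.

(** Expand along the first axis [j]. Terms in which [j] occurs twice vanish: for equal signs by
    [wedge_wedge], for opposite signs by [wedge_disjoint], as no complementary pair of labels
    occurs. Moving the labels of [L] past [lab j e] and using the induction hypothesis yields a
    second copy of [wedge (lab j e) (fan e L)], which cancels the first. *)
Lemma wedge_labelled_fan e L s :
  (forall j x y, In x s -> In y s -> lab j true x && lab j false y = false) ->
  wedge (labelled L) (fan e L) s = xorb (fan e L s) (fan (negb e) L s).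
Proof.
  revert e s; induction L as [|j L IH]; intros e s Hs.
  - simpl. rewrite wedge_false_form. now destruct s.
  - assert (Hd : forall e' phi, wedge (lab j e') (wedge (lab j (negb e')) phi) s = false).
    { intros e' phi. apply wedge_disjoint. intros x y Hx Hy.
      destruct e'; simpl; auto. rewrite andb_comm. auto. }
    assert (Hc : wedge (labelled L) (wedge (lab j e) (fan (negb e) L)) s =
      xorb (wedge (lab j e) (fan e L) s) (wedge (lab j e) (fan (negb e) L) s)).
    { rewrite wedge_comm, <- wedge_xor. apply wedge_ext; auto.
      intros t _ Ht. rewrite IH by auto. now rewrite negb_involutive, xorb_comm. }
    cbn [labelled fan]. rewrite !wedge_xor_form, !wedge_xor, (IH e s Hs), Hc.
    rewrite negb_involutive.
    destruct e; simpl negb in *;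
      rewrite ?wedge_wedge, ?Hd;
      pose proof (Hd false (fan false L)) as H1; pose proof (Hd true (fan true L)) as H2;
      simpl negb in H1, H2; rewrite ?H1, ?H2;
      destruct (fan true L s), (fan false L s), (wedge (lab j true) (fan true L) s),
        (wedge (lab j true) (fan false L) s), (wedge (lab j false) (fan true L) s),
        (wedge (lab j false) (fan false L) s); simpl in *; auto.
Qed.

(** Here [labelled L] is constantly true on [s], so the product in [wedge_labelled_fan] is the
    coboundary. This is the parity count behind Tucker's lemma. *)
Lemma delta_fan e L s :
  (forall j x y, In x s -> In y s -> lab j true x && lab j false y = false) ->
  (forall x, In x s -> labelled L x = true) ->
  delta (fan e L) s = xorb (fan e L s) (fan (negb e) L s).
Proof.
  intros H1 H2. rewrite <- wedge_labelled_fan by auto.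
  apply wedge_ext; auto. intros x Hx. now rewrite H2.
Qed.

(* The chain of all [2 ^ length L] facets of the cross-polytope with vertices
   [v i true], [v i false]. *)
Context (v : J -> bool -> T).

Fixpoint cross (L : list J) phi : bool :=
  match L with
  | [] => phi []
  | i :: L => xorb (cross L (fun t => phi (v i true :: t)))
                   (cross L (fun t => phi (v i false :: t)))
  end.

Lemma cross_xor L phi psi :
  cross L (fun t => xorb (phi t) (psi t)) = xorb (cross L phi) (cross L psi).
Proof.
  revert phi psi; induction L as [|i L IH]; intros phi psi; simpl; auto.
  rewrite !(IH (fun t => phi (_ :: t)) (fun t => psi (_ :: t))).
  destruct (cross L _), (cross L _), (cross L _), (cross L _); reflexivity.
Qed.

Lemma cross_false L : cross L (fun _ => false) = false.
Proof. induction L as [|i L IH]; simpl; auto. now rewrite IH. Qed.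

(** The facets form a cycle: deleting [v i true] or [v i false] leaves the same ridge, which is thus
    counted twice. *)
Lemma cross_delta L phi : cross L (delta phi) = false.
Proof.
  revert phi; induction L as [|i L IH]; intros phi; [reflexivity|].
  cbn [cross].
  change (xorb (cross L (fun t => xorb (phi t) (delta (fun u => phi (v i true :: u)) t)))
    (cross L (fun t => xorb (phi t) (delta (fun u => phi (v i false :: u)) t))) = false).
  rewrite !cross_xor, !IH. now destruct (cross L _).
Qed.

(** Without repetitions in [L], the signs picked axis by axis combine into a single function [sg],
    so each facet has the displayed form. *)
Lemma cross_ext (J_dec : forall i j : J, {i = j} + {i <> j}) L phi psi :
  NoDup L ->
  (forall sg : J -> bool, phi (map (fun i => v i (sg i)) L) = psi (map (fun i => v i (sg i)) L)) ->
  cross L phi = cross L psi.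
Proof.
  revert phi psi; induction L as [|i L IH]; intros phi psi HL H; simpl.
  - apply (H (fun _ => true)).
  - inversion HL as [|? ? Hi HL']; subst.
    assert (Hu : forall e sg, phi (v i e :: map (fun j => v j (sg j)) L) =
                         psi (v i e :: map (fun j => v j (sg j)) L)).
    { intros e sg.
      set (sg' j := if J_dec j i then e else sg j).
      replace e with (sg' i) by (unfold sg'; now destruct (J_dec i i)).
      rewrite <- (map_ext_in (fun j => v j (sg' j))).
      - apply (H sg').
      - intros j Hj. unfold sg'. destruct (J_dec j i); congruence. }
    f_equal; apply IH; auto.
Qed.

Lemma cross_map (U : T -> T) L phi :
  (forall i e, U (v i e) = v i (negb e)) ->
  cross L (fun t => phi (map U t)) = cross L phi.
Proof.
  intros HU; revert phi; induction L as [|i L IH]; intros phi; simpl; auto.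
  rewrite !HU. simpl.
  rewrite (IH (fun t => phi (v i false :: t))), (IH (fun t => phi (v i true :: t))).
  apply xorb_comm.
Qed.

End Cochains.

(** * Tucker's lemma *)

Fixpoint fins (n : nat) : list (Fin.t n) :=
  match n with
  | O => []
  | S n => Fin.F1 :: map Fin.FS (fins n)
  end.

Lemma fins_In n (i : Fin.t n) : In i (fins n).
Proof.
  induction i as [n|n i IH]; simpl; auto.
  right. now apply in_map.
Qed.

Lemma fins_length n : length (fins n) = n.
Proof. induction n as [|n IH]; simpl; auto. now rewrite length_map, IH. Qed.

Lemma fins_NoDup n : NoDup (fins n).
Proof.
  induction n as [|n IH]; simpl; constructor.
  - intros H. apply in_map_iff in H. destruct H as [i [H _]]. discriminate.
  - apply NoDup_map_NoDup_ForallPairs; auto.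
    intros i j _ _ H. now apply Fin.FS_inj.
Qed.

(** * Finite real sums *)

Definition lsum {A : Type} (f : A -> R) (l : list A) : R :=
  fold_right (fun x r => f x + r) 0 l.

Lemma lsum_le {A} (f g : A -> R) l :
  (forall x, In x l -> f x <= g x) -> lsum f l <= lsum g l.
Proof.
  induction l as [|x l IH]; simpl; intros H; [lra|].
  specialize (IH (fun y Hy => H y (or_intror Hy))).
  specialize (H x (or_introl eq_refl)). lra.
Qed.

Lemma lsum_eq {A} (f g : A -> R) l :
  (forall x, In x l -> f x = g x) -> lsum f l = lsum g l.
Proof. intros H; apply Rle_antisym; apply lsum_le; intros x Hx; rewrite H; auto; lra. Qed.

Lemma lsum_const {A} (c : R) (l : list A) : lsum (fun _ => c) l = INR (length l) * c.
Proof.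
  induction l as [|x l IH]; [simpl; lra|].
  cbn [lsum length fold_right] in *. fold (lsum (fun _ : A => c) l). rewrite S_INR, IH. lra.
Qed.

Lemma lsum_scal {A} (c : R) (f : A -> R) l : lsum (fun x => c * f x) l = c * lsum f l.
Proof. induction l as [|x l IH]; simpl in *; [lra|rewrite IH; lra]. Qed.

Lemma lsum_plus {A} (f g : A -> R) l : lsum (fun x => f x + g x) l = lsum f l + lsum g l.
Proof. induction l as [|x l IH]; simpl in *; [lra|rewrite IH; lra]. Qed.

Lemma lsum_swap {A B} (F : A -> B -> R) l m :
  lsum (fun x => lsum (F x) m) l = lsum (fun y => lsum (fun x => F x y) l) m.
Proof.
  induction l as [|x l IH]; simpl.
  - rewrite lsum_const. lra.
  - change (lsum (F x) m + lsum (fun x => lsum (F x) m) l =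
            lsum (fun y => F x y + lsum (fun x => F x y) l) m).
    now rewrite lsum_plus, IH.
Qed.

Lemma lsum_map {A B} (F : A -> B) (f : B -> R) l : lsum f (map F l) = lsum (fun x => f (F x)) l.
Proof. induction l as [|x l IH]; simpl in *; [lra|rewrite IH; lra]. Qed.

Lemma lsum_ge0 {A} (f : A -> R) l : (forall x, In x l -> 0 <= f x) -> 0 <= lsum f l.
Proof.
  intros H. pose proof (lsum_le (fun _ => 0) f l H) as H1. rewrite lsum_const in H1. lra.
Qed.

Lemma lsum_ge_term {A} (f : A -> R) l y :
  (forall x, In x l -> 0 <= f x) -> In y l -> f y <= lsum f l.
Proof.
  induction l as [|x l IH]; simpl; intros H []; [subst|].
  - pose proof (lsum_ge0 f l (fun z Hz => H z (or_intror Hz))). unfold lsum in *. lra.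
  - pose proof (IH (fun z Hz => H z (or_intror Hz)) H0).
    specialize (H x (or_introl eq_refl)). unfold lsum in *. lra.
Qed.

Lemma lsum_single {A} (f : A -> R) l y :
  NoDup l -> In y l -> (forall x, In x l -> x <> y -> f x = 0) -> lsum f l = f y.
Proof.
  induction l as [|x l IH]; simpl; intros Hl Hy H; [easy|].
  inversion Hl as [|? ? Hx Hl']; subst.
  destruct Hy as [->|Hy].
  - fold (lsum f l). rewrite (lsum_eq f (fun _ => 0)).
    + rewrite lsum_const. lra.
    + intros z Hz. apply H; auto. intros ->; auto.
  - fold (lsum f l). rewrite IH; auto. rewrite H; auto; [lra|]. intros ->; auto.
Qed.

(** * Barycentres and the mesh of iterated subdivisions *)

Definition bary {n} (s : list (Vec n)) : Vec n :=
  fun i => lsum (fun v : Vec n => v i) s / INR (length s).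

(** The amount of convexity that barycentric subdivision respects; [in_hull] quantifies over such
    sets in place of forming a convex hull. *)
Definition bary_closed {n} (C : Vec n -> Prop) : Prop :=
  forall s, s <> [] -> (forall v, In v s -> C v) -> C (bary s).

Definition small {n} (d : R) (s : list (Vec n)) : Prop :=
  forall v w, In v s -> In w s -> forall i, Rabs (v i - w i) <= d.

Lemma length_pos {A} (s : list A) : s <> [] -> 0 < INR (length s).
Proof. intros H. apply lt_0_INR. destruct s; simpl; [easy|lia]. Qed.

Lemma average_le {A} (f : A -> R) s r :
  s <> [] -> (forall v, In v s -> f v <= r) -> lsum f s / INR (length s) <= r.
Proof.
  intros Hs H. pose proof (length_pos s Hs) as Hp.
  apply Rmult_le_reg_r with (INR (length s)); auto.
  unfold Rdiv. rewrite Rmult_assoc, Rinv_l, Rmult_1_r by lra.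
  rewrite Rmult_comm, <- lsum_const. now apply lsum_le.
Qed.

Lemma average_ge {A} (f : A -> R) s r :
  s <> [] -> (forall v, In v s -> r <= f v) -> r <= lsum f s / INR (length s).
Proof.
  intros Hs H. pose proof (length_pos s Hs) as Hp.
  apply Rmult_le_reg_r with (INR (length s)); auto.
  unfold Rdiv. rewrite Rmult_assoc, Rinv_l, Rmult_1_r by lra.
  rewrite Rmult_comm, <- lsum_const. now apply lsum_le.
Qed.

Definition lin {n} (c v : Vec n) : R := lsum (fun i => c i * v i) (fins n).

Lemma lin_bary {n} (c : Vec n) s :
  lin c (bary s) = lsum (lin c) s / INR (length s).
Proof.
  unfold lin. rewrite lsum_swap. unfold Rdiv. rewrite (Rmult_comm (lsum _ _)), <- lsum_scal.
  apply lsum_eq. intros i _. unfold bary. rewrite lsum_scal. unfold Rdiv. ring.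
Qed.

Lemma Rabs_le_bounds x r : Rabs x <= r -> - r <= x <= r.
Proof.
  intros H. pose proof (Rle_abs x). pose proof (Rle_abs (- x)).
  rewrite Rabs_Ropp in *. lra.
Qed.

Lemma bary_closed_box {n} (c : Vec n) r : bary_closed (fun v => forall i, Rabs (v i - c i) <= r).
Proof.
  intros s Hs H i.
  assert (H1 : bary s i <= c i + r).
  { apply (average_le (fun v : Vec n => v i)); auto. intros v Hv.
    specialize (H v Hv i). apply Rabs_le_bounds in H. lra. }
  assert (H2 : c i - r <= bary s i).
  { apply (average_ge (fun v : Vec n => v i)); auto. intros v Hv.
    specialize (H v Hv i). apply Rabs_le_bounds in H. lra. }
  apply Rabs_le. lra.
Qed.

(** The difference is the average of [v - w] over all [w] in [s], and the term with [w = v] is zero,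
    so of [k] terms only [k - 1] contribute. *)
Lemma bary_dist {n} (N : nat) (d : R) (s : list (Vec n)) v i :
  small d s -> (length s <= N)%nat -> In v s ->
  Rabs (v i - bary s i) <= (INR N - 1) / INR N * d.
Proof.
  intros Hd HN Hv.
  assert (Hs : s <> []) by (now intros ->).
  pose proof (length_pos s Hs) as Hp.
  assert (Hd0 : 0 <= d) by (eapply Rle_trans; [apply Rabs_pos|apply (Hd v v Hv Hv i)]).
  assert (Hsum : forall l : list (Vec n), incl l s ->
     Rabs (INR (length l) * v i - lsum (fun w : Vec n => w i) l) <= INR (length l) * d
     /\ (In v l -> Rabs (INR (length l) * v i - lsum (fun w : Vec n => w i) l) <= (INR (length l) - 1) * d)).
  { induction l as [|w l IH]; intros Hl.
    - simpl. split; [rewrite Rabs_right; lra|easy].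
    - destruct (IH (fun z Hz => Hl z (or_intror Hz))) as [IH1 IH2].
      pose proof (Hd v w Hv (Hl w (or_introl eq_refl)) i) as Hw.
      cbn [length]. rewrite S_INR. cbn [lsum fold_right].
      fold (lsum (fun w : Vec n => w i) l).
      replace ((INR (length l) + 1) * v i - (w i + lsum (fun w0 : Vec n => w0 i) l))
        with ((v i - w i) + (INR (length l) * v i - lsum (fun w0 : Vec n => w0 i) l)) by ring.
      pose proof (Rabs_triang (v i - w i) (INR (length l) * v i - lsum (fun w0 : Vec n => w0 i) l)).
      split; [lra|]. intros [->|Hin].
      + replace (v i - v i) with 0 by ring. rewrite Rplus_0_l. lra.
      + specialize (IH2 Hin). lra. }
  destruct (Hsum s (incl_refl s)) as [_ H]. specialize (H Hv).
  assert (HNp : 0 < INR N) by (pose proof (le_INR _ _ HN); lra).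
  replace (v i - bary s i) with ((INR (length s) * v i - lsum (fun w : Vec n => w i) s) * / INR (length s))
    by (unfold bary; field; lra).
  rewrite Rabs_mult, (Rabs_right (/ _)) by (apply Rle_ge, Rlt_le, Rinv_0_lt_compat; lra).
  apply Rle_trans with ((INR (length s) - 1) * d * / INR (length s)).
  - apply Rmult_le_compat_r; auto. apply Rlt_le, Rinv_0_lt_compat; lra.
  - replace ((INR (length s) - 1) * d * / INR (length s)) with ((1 - / INR (length s)) * d)
      by (field; lra).
    replace ((INR N - 1) / INR N) with (1 - / INR N) by (field; lra).
    apply Rmult_le_compat_r; auto.
    assert (/ INR N <= / INR (length s)) by (apply Rinv_le_contravar; [lra|now apply le_INR]).
    lra.
Qed.

Definition in_hull {n} (s t : list (Vec n)) : Prop :=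
  forall C, bary_closed C -> (forall v, In v s -> C v) -> forall v, In v t -> C v.

(** The simplices of the subdivision are never named. That they are short, lie in the hull of [s]
    and have smaller mesh is expressed by comparing two cochains that agree on all lists with these
    properties. *)
Lemma sd_local {n} (N : nat) (d : R) phi psi (s : list (Vec n)) :
  (length s <= N)%nat -> small d s ->
  (forall t, length t = length s -> in_hull s t -> small ((INR N - 1) / INR N * d) t ->
     phi t = psi t) ->
  sd bary phi s = sd bary psi s.
Proof.
  remember (length s) as k eqn:Hk. revert s phi psi Hk.
  induction k as [|k IH]; intros s phi psi Hk HN Hd H.
  - destruct s; [|discriminate]. apply H; auto; [now intros C|now intros v].
  - assert (Hs : s <> []) by (now destruct s).
    rewrite !sd_unfold by auto. apply wedge_ext; auto.
    intros t Ht Hi. apply IH; [lia|lia| |].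
    + intros v w Hv Hw; apply Hd; auto.
    + intros u Hu Hc Hsm. apply H; [simpl; lia| |].
      * intros C HC HCs v [<-|Hv]; [now apply HC|]. apply (Hc C); auto.
      (* The box around [bary s] contains [s] and is [bary_closed], hence contains every vertex of
         the subdivided face [u]. *)
      * assert (Hb : forall v, In v u -> forall i,
            Rabs (v i - bary s i) <= (INR N - 1) / INR N * d).
        { apply (Hc (fun v => forall i, Rabs (v i - bary s i) <= (INR N - 1) / INR N * d)).
          - apply bary_closed_box.
          - intros v Hv i. apply bary_dist; auto; lia. }
        assert (Hd0 : forall i : Fin.t n, 0 <= (INR N - 1) / INR N * d).
        { intros i. destruct s as [|v s]; [easy|].
          eapply Rle_trans; [apply Rabs_pos|].
          apply (bary_dist N d (v :: s) v i); [auto|lia|simpl; auto]. }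
        intros v w [<-|Hv] [<-|Hw] i; auto.
        -- replace (bary s i - bary s i) with 0 by ring. rewrite Rabs_R0. apply Hd0, i.
        -- rewrite Rabs_minus_sym. auto.
Qed.

Lemma sdn_local {n} (N m : nat) (d : R) phi psi (s : list (Vec n)) :
  (length s <= N)%nat -> small d s ->
  (forall t, length t = length s -> in_hull s t -> small (((INR N - 1) / INR N) ^ m * d) t ->
     phi t = psi t) ->
  sdn bary m phi s = sdn bary m psi s.
Proof.
  revert d s; induction m as [|m IH]; intros d s HN Hd H.
  - simpl. apply H; auto.
    + intros C HC H0; exact H0.
    + now rewrite Rmult_1_l.
  - cbn [sdn]. apply (sd_local N d); auto.
    intros t Ht Hc Hsm. apply (IH ((INR N - 1) / INR N * d)); [lia|auto|].
    intros u Hu Hcu Hsu. apply H; [congruence| |].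
    + intros C HC HCs. apply Hcu; [exact HC|]. now apply Hc.
    + cbn [pow]. rewrite <- Rmult_assoc in Hsu. now rewrite (Rmult_comm (_ / _) (_ ^ m)).
Qed.

(** * The cross-polytope and Tucker's lemma on its subdivisions *)

Definition l1 {n} (v : Vec n) : R := lsum (fun i => Rabs (v i)) (fins n).
Definition vneg {n} (v : Vec n) : Vec n := fun i => - v i.
Definition unitv {n} (i : Fin.t n) (e : bool) : Vec n :=
  fun j => if Fin.eq_dec i j then (if e then 1 else -1) else 0.

Lemma bary_vneg {n} (s : list (Vec n)) : bary (map vneg s) = vneg (bary s).
Proof.
  apply functional_extensionality; intros i. unfold bary, vneg. rewrite length_map.
  rewrite lsum_map, (lsum_eq _ (fun v : Vec n => -1 * v i)) by (intros; ring).
  rewrite lsum_scal. unfold Rdiv. ring.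
Qed.

Lemma vneg_unitv {n} (i : Fin.t n) e : vneg (unitv i e) = unitv i (negb e).
Proof.
  apply functional_extensionality; intros j. unfold vneg, unitv.
  destruct (Fin.eq_dec i j), e; simpl; lra.
Qed.

Lemma l1_unitv {n} (i : Fin.t n) e : l1 (unitv i e) = 1.
Proof.
  unfold l1. rewrite (lsum_single _ _ i).
  - unfold unitv. destruct (Fin.eq_dec i i); [|easy].
    destruct e; [rewrite Rabs_right|rewrite Rabs_left]; lra.
  - apply fins_NoDup.
  - apply fins_In.
  - intros j _ Hj. unfold unitv. destruct (Fin.eq_dec i j); [congruence|apply Rabs_R0].
Qed.

(** With the signs [c] of the coordinates of [bary s] frozen, [lin c] equals the norm at [bary s]
    and is at most the norm at every vertex. *)
Lemma bary_closed_l1_ball {n} : bary_closed (fun v : Vec n => l1 v <= 1).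
Proof.
  intros s Hs H. set (c i := if Rle_dec 0 (bary s i) then 1 else -1).
  replace (l1 (bary s)) with (lin c (bary s)).
  - rewrite lin_bary. apply average_le; auto. intros v Hv.
    apply Rle_trans with (l1 v); auto. apply lsum_le. intros i _. unfold c.
    pose proof (Rle_abs (v i)). pose proof (Rle_abs (- v i)). rewrite Rabs_Ropp in *.
    destruct Rle_dec; lra.
  - apply lsum_eq. intros i _. unfold c.
    destruct Rle_dec; [rewrite Rabs_right|rewrite Rabs_left]; lra.
Qed.

(** The facet of the cross-polytope in the orthant [sg]. The unit sphere of [l1] is in general not
    closed under barycentres, but each facet is; this keeps subdivided facets where the labels are
    odd. *)
Definition face {n} (sg : Fin.t n -> bool) (v : Vec n) : Prop :=
  lin (fun i => if sg i then 1 else -1) v = 1 /\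
  forall i, 0 <= (if sg i then 1 else -1) * v i.

Lemma bary_closed_face {n} (sg : Fin.t n -> bool) : bary_closed (face sg).
Proof.
  intros s Hs H. split.
  - rewrite lin_bary. apply Rle_antisym.
    + apply average_le; auto. intros v Hv. apply Req_le, H, Hv.
    + apply average_ge; auto. intros v Hv. apply Req_le, eq_sym, H, Hv.
  - intros i. unfold bary, Rdiv. rewrite <- Rmult_assoc, <- lsum_scal.
    apply average_ge; auto. intros v Hv. apply H; auto.
Qed.

Lemma face_l1 {n} sg (v : Vec n) : face sg v -> l1 v = 1.
Proof.
  intros [Hs H]. rewrite <- Hs. apply lsum_eq. intros i _. specialize (H i). revert H. cbv beta.
  destruct (sg i); intros H; [rewrite Rabs_right|rewrite Rabs_left1]; lra.
Qed.

Lemma face_unitv {n} sg (i : Fin.t n) : face sg (unitv i (sg i)).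
Proof.
  split.
  - unfold lin. rewrite (lsum_single _ _ i).
    + unfold unitv. destruct (Fin.eq_dec i i); [|easy]. destruct (sg i); lra.
    + apply fins_NoDup.
    + apply fins_In.
    + intros j _ Hj. unfold unitv. destruct (Fin.eq_dec i j); [congruence|lra].
  - intros j. unfold unitv. destruct (Fin.eq_dec i j) as [->|]; [destruct (sg j)|]; lra.
Qed.

Lemma l1_coord {n} (v : Vec n) i : Rabs (v i) <= l1 v.
Proof.
  apply (lsum_ge_term (fun i => Rabs (v i))); [intros; apply Rabs_pos|apply fins_In].
Qed.

Lemma l1_ball_small {n} (s : list (Vec n)) : (forall v, In v s -> l1 v <= 1) -> small 2 s.
Proof.
  intros H v w Hv Hw i.
  pose proof (l1_coord v i). pose proof (l1_coord w i).
  pose proof (H v Hv). pose proof (H w Hw). pose proof (Rabs_triang (v i) (- w i)).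
  rewrite Rabs_Ropp in *. unfold Rminus. lra.
Qed.

(** Fan's cochain on a fine subdivision has odd total on the boundary sphere, by induction on the
    dimension. The sphere bounds the cone from the origin, on whose full simplices the coboundary of
    the cochain vanishes. *)
Lemma tucker {n} (lab : Fin.t n -> bool -> Vec n -> bool) (d : R) :
  0 < d ->
  (forall v, l1 v <= 1 -> labelled lab (fins n) v = true) ->
  (forall v, l1 v = 1 -> forall j e, lab j e (vneg v) = lab j (negb e) v) ->
  (forall v w, l1 v <= 1 -> l1 w <= 1 -> (forall i, Rabs (v i - w i) <= d) ->
     forall j, lab j true v && lab j false w = false) ->
  False.
Proof.
  intros Hd Hlab Hodd Hsmall.
  set (N := S n). set (th := (INR N - 1) / INR N).
  assert (HN : 1 <= INR N) by (unfold N; rewrite S_INR; pose proof (pos_INR n); lra).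
  assert (Hth : 0 <= th < 1).
  { unfold th; split.
    - apply Rmult_le_pos; [lra|]. apply Rlt_le, Rinv_0_lt_compat; lra.
    - apply Rmult_lt_reg_r with (INR N); [lra|]. unfold Rdiv.
      rewrite Rmult_assoc, Rinv_l; lra. }
  (* Points of the [l1] ball differ by at most [2] in each coordinate, so [m] subdivisions bring the
     mesh below [d]. *)
  destruct (pow_lt_1_zero th) with (y := d / 2) as [m Hm]; [rewrite Rabs_right; lra|lra|].
  specialize (Hm m (le_n m)). rewrite Rabs_right in Hm by (apply Rle_ge, pow_le; lra).
  assert (Hball : forall s t, (forall v : Vec n, In v s -> l1 v <= 1) -> in_hull s t ->
     forall v, In v t -> l1 v <= 1).
  { intros s t Hs Ht. apply Ht; auto. apply bary_closed_l1_ball. }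
  set (Phi e := sdn bary m (fan lab e (fins n))).
  assert (HPhi : forall e s, (length s <= N)%nat -> (forall v, In v s -> l1 v <= 1) ->
     delta (Phi e) s = xorb (Phi e s) (Phi (negb e) s)).
  { intros e s Hs H1. unfold Phi. rewrite <- sdn_delta, <- sdn_xor.
    apply (sdn_local N m 2); [exact Hs|now apply l1_ball_small|].
    intros t _ Ht Hsm. apply delta_fan.
    - intros j v w Hv Hw. apply Hsmall; try (eapply Hball; eauto).
      intros i. eapply Rle_trans; [now apply Hsm|]. fold th. lra.
    - intros v Hv. apply Hlab. eapply Hball; eauto. }
  assert (Hneg : forall e L sg, (length L <= n)%nat ->
     Phi e (map vneg (map (fun i => unitv i (sg i)) L)) =
     Phi (negb e) (map (fun i => unitv i (sg i)) L)).
  { intros e L sg HL. unfold Phi. rewrite sdn_map by apply bary_vneg.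
    apply (sdn_local N m 2).
    - rewrite length_map. unfold N; lia.
    - apply l1_ball_small. intros v Hv. apply in_map_iff in Hv.
      destruct Hv as [i [<- _]]. rewrite l1_unitv. lra.
    - intros t _ Ht _. apply fan_flip. intros v j e' Hv. apply Hodd.
      apply (face_l1 sg). apply Ht; auto using bary_closed_face.
      intros w Hw. apply in_map_iff in Hw. destruct Hw as [i [<- _]]. apply face_unitv. }
  assert (Hunit : forall L sg (v : Vec n), In v (map (fun i => unitv i (sg i)) L) -> l1 v <= 1).
  { intros L sg v Hv. apply in_map_iff in Hv. destruct Hv as [i [<- _]].
    rewrite l1_unitv. lra. }
  (* The sphere on [i :: L] is two hemispheres, cones over the equator on [L]. The antipodal map
     turns the lower one into the upper one with [e] negated, so by [HPhi] the total is the
     coboundary summed over the upper cone, which is the total on the equator. *)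
  assert (Hcross : forall L e, NoDup L -> (length L <= n)%nat -> cross unitv L (Phi e) = true).
  { induction L as [|i L IH]; intros e HL Hlen.
    - cbn [cross]. unfold Phi. now rewrite sdn_nil, fan_nil.
    - inversion HL as [|? ? Hi HL']; subst. cbn [length] in Hlen.
      rewrite <- (IH e HL') at 1 by lia. cbn [cross].
      rewrite <- (cross_map unitv vneg L (fun t => Phi e (unitv i false :: t)))
        by apply vneg_unitv.
      rewrite <- cross_xor.
      transitivity (cross unitv L (fun t => delta (Phi e) (unitv i true :: t))).
      + apply cross_ext; auto using Fin.eq_dec. intros sg.
        rewrite HPhi.
        * f_equal.
          (* [sg'] includes the apex [unitv i true] among the signed vertices; as [i] is not in [L],
             it changes nothing there. *)
          set (sg' j := if Fin.eq_dec i j then true else sg j).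
          replace (map (fun j => unitv j (sg j)) L) with (map (fun j => unitv j (sg' j)) L).
          2:{ apply map_ext_in. intros j Hj. unfold sg'.
              destruct (Fin.eq_dec i j); [congruence|reflexivity]. }
          assert (Hi' : sg' i = true) by (unfold sg'; now destruct (Fin.eq_dec i i)).
          pose proof (Hneg e (i :: L) sg' ltac:(simpl; lia)) as H.
          cbn [map] in H. rewrite vneg_unitv, Hi' in H. exact H.
        * cbn [length]. rewrite length_map. unfold N; lia.
        * intros v [<-|Hv]; [rewrite l1_unitv; lra|eauto].
      + change (cross unitv L (fun t => xorb (Phi e t)
          (delta (fun u => Phi e (unitv i true :: u)) t)) = cross unitv L (Phi e)).
        rewrite cross_xor, cross_delta. apply xorb_false_r. }
  assert (Hz : forall v, In v [fun _ : Fin.t n => 0] -> l1 v <= 1).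
  { intros v [<-|[]]. unfold l1. rewrite (lsum_eq _ (fun _ => 0)); [rewrite lsum_const; lra|].
    intros; apply Rabs_R0. }
  (* The same cone formula with the origin as apex reduces this sum to the total on the sphere. *)
  assert (H : cross unitv (fins n) (fun t => delta (Phi true) ((fun _ => 0) :: t)) = true).
  { change (cross unitv (fins n) (fun t => xorb (Phi true t)
        (delta (fun u => Phi true ((fun _ => 0) :: u)) t)) = true).
    rewrite cross_xor, cross_delta, Hcross; auto using fins_NoDup.
    now rewrite fins_length. }
  rewrite (cross_ext unitv Fin.eq_dec (fins n) _ (fun _ => false)) in H; [|apply fins_NoDup|].
  - now rewrite cross_false in H.
  - intros sg.
    assert (H1 : forall v, In v ((fun _ => 0) :: map (fun i => unitv i (sg i)) (fins n)) -> l1 v <= 1).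
    { intros v [Hv|Hv]; [apply Hz; simpl; auto|eauto]. }
    assert (H2 : length ((fun _ => 0) :: map (fun i => unitv i (sg i)) (fins n)) = N).
    { cbn [length]. now rewrite length_map, fins_length. }
    rewrite HPhi; [|exact (Nat.eq_le_incl _ _ H2)|exact H1].
    (* A full simplex has [n + 1] vertices, more than there are axes. *)
    assert (H3 : forall e, Phi e ((fun _ => 0) :: map (fun i => unitv i (sg i)) (fins n)) = false).
    { intros e. unfold Phi.
      transitivity (sdn bary m (fun _ => false) ((fun _ => 0) :: map (fun i => unitv i (sg i)) (fins n))).
      - apply (sdn_local N m 2); [exact (Nat.eq_le_incl _ _ H2)|now apply l1_ball_small|].
        intros t Ht _ _. apply fan_long. rewrite Ht, fins_length. apply Nat.eq_le_incl. symmetry. exact H2.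
      - pose proof (sdn_xor bary m (fun _ => false) (fun _ => false)
          ((fun _ => 0) :: map (fun i => unitv i (sg i)) (fins n))) as H4.
        rewrite xorb_nilpotent in H4. exact H4. }
    now rewrite !H3.
Qed.

(** * Compactness and the Borsuk-Ulam theorem *)

Lemma list_min {A : Type} (P : A -> R -> Prop) (l : list A) :
  (forall x r r', 0 < r' <= r -> P x r -> P x r') ->
  (forall x, In x l -> exists r, 0 < r /\ P x r) ->
  exists r, 0 < r /\ forall x, In x l -> P x r.
Proof.
  intros Hm; induction l as [|x l IH]; intros H.
  - exists 1; split; [lra|easy].
  - destruct IH as [r [Hr Hl]]; [intros; apply H; simpl; auto|].
    destruct (H x) as [r' [Hr' Hx]]; [simpl; auto|].
    exists (Rmin r r'). split; [now apply Rmin_pos|].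
    pose proof (Rmin_l r r'). pose proof (Rmin_r r r'). pose proof (Rmin_pos r r' Hr Hr').
    intros y [<-|Hy]; [apply Hm with r'|apply Hm with r]; auto.
Qed.

Lemma fin_min {n} (P : Fin.t n -> R -> Prop) :
  (forall i r r', 0 < r' <= r -> P i r -> P i r') ->
  (forall i, exists r, 0 < r /\ P i r) ->
  exists r, 0 < r /\ forall i, P i r.
Proof.
  intros Hm H. destruct (list_min P (fins n)) as [r [Hr Hl]]; auto.
  exists r. split; auto. intros i. apply Hl, fins_In.
Qed.

(** What the covering arguments use of a metric, in a form that passes to products. *)
Record ball_ok {T : Type} (ball : T -> R -> T -> Prop) : Prop := {
  ball_center : forall x r, 0 < r -> ball x r x;
  ball_mono : forall x r r' y, r <= r' -> ball x r y -> ball x r' y;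
  ball_open : forall x r, is_open ball (ball x r) }.

Definition prod_ball {A B : Type} (bA : A -> R -> A -> Prop) (bB : B -> R -> B -> Prop)
  (p : A * B) (r : R) (q : A * B) : Prop := bA (fst p) r (fst q) /\ bB (snd p) r (snd q).

Lemma ball_ok_prod {A B : Type} (bA : A -> R -> A -> Prop) (bB : B -> R -> B -> Prop) :
  ball_ok bA -> ball_ok bB -> ball_ok (prod_ball bA bB).
Proof.
  intros [a1 a2 a3] [b1 b2 b3]; split; unfold prod_ball.
  - auto.
  - intros x r r' y Hr [H1 H2]; eauto.
  - intros x r y [H1 H2].
    destruct (a3 _ _ _ H1) as [r1 [Hr1 H3]]. destruct (b3 _ _ _ H2) as [r2 [Hr2 H4]].
    exists (Rmin r1 r2). split; [now apply Rmin_pos|].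
    intros z [H5 H6]. split; [apply H3|apply H4].
    + eapply a2; [apply Rmin_l|]; eauto.
    + eapply b2; [apply Rmin_r|]; eauto.
Qed.

Lemma ball_ok_R : ball_ok ballR.
Proof.
  split; unfold ballR.
  - intros x r Hr. replace (x - x) with 0 by ring. now rewrite Rabs_R0.
  - intros; lra.
  - intros x r y Hy. exists (r - Rabs (y - x)). split; [lra|].
    intros z Hz. replace (z - x) with ((z - y) + (y - x)) by ring.
    pose proof (Rabs_triang (z - y) (y - x)). lra.
Qed.

Lemma ball_ok_V n : ball_ok (ballV n).
Proof.
  destruct ball_ok_R as [h1 h2 h3].
  split.
  - intros x r Hr i. now apply h1.
  - intros x r r' y Hr H i. specialize (H i). lra.
  - intros x r y Hy.
    destruct (fin_min (fun i s => forall z, ballR (y i) s z -> ballR (x i) r z)) as [s [Hs H]].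
    + intros i s s' Hs H z Hz. apply H. apply (h2 _ s'); [lra|auto].
    + intros i. apply (h3 _ _ _ (Hy i)).
    + exists s. split; auto. intros z Hz i. apply H, Hz.
Qed.

Lemma ball_ok_O n : ball_ok (ballO n).
Proof. exact (ball_ok_prod _ _ ball_ok_R (ball_ok_V n)). Qed.

(** [Q] is a condition on the index of a cover: all pairs of centre and radius may serve as indices,
    the unsuitable ones giving the empty set. *)
Lemma is_open_and {T} (ball : T -> R -> T -> Prop) (S : T -> Prop) (Q : Prop) :
  is_open ball S -> is_open ball (fun x => S x /\ Q).
Proof.
  intros HS x [Hx HQ]. destruct (HS x Hx) as [r [Hr H]]. exists r; auto.
Qed.

(** Local-to-global principle used for uniform continuity, positive lower bounds and boundedness
    alike: the least radius of a finite subcover works everywhere. *)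
Lemma compact_uniform {T} (ball : T -> R -> T -> Prop) (K : T -> Prop) (P : T -> R -> Prop) :
  ball_ok ball -> is_compact ball K ->
  (forall y r r', 0 < r' <= r -> P y r -> P y r') ->
  (forall x, K x -> exists r, 0 < r /\ forall y, ball x r y -> K y -> P y r) ->
  exists r, 0 < r /\ forall y, K y -> P y r.
Proof.
  intros [h1 h2 h3] HK Hm H.
  destruct (HK (T * R)%type (fun a y => ball (fst a) (snd a) y /\
     (0 < snd a /\ forall z, ball (fst a) (snd a) z -> K z -> P z (snd a)))) as [l Hl].
  - intros a. now apply is_open_and.
  - intros x Hx. destruct (H x Hx) as [r [Hr HP]]. exists (x, r). simpl. auto.
  (* Indices with non-positive radius impose no constraint, hence the default [1] for them. *)
  - destruct (list_min (fun a r => 0 < snd a -> r <= snd a) l) as [r [Hr Hmin]].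
    + intros a r r' Hr Ha Ha'. specialize (Ha Ha'). lra.
    + intros [x r] _. simpl. destruct (Rlt_dec 0 r) as [Hr|Hr].
      * exists r; split; [auto|]. intros; lra.
      * exists 1; split; [lra|]. intros; lra.
    + exists r. split; auto. intros y Hy.
      destruct (Hl y Hy) as [a [Ha [Hb [Hp HP]]]].
      apply Hm with (snd a); auto.
Qed.

(** Tube lemma: finitely many sets cover a strip around each slice, and finitely many strips cover
    the product. *)
Lemma compact_prod {A B} (bA : A -> R -> A -> Prop) (bB : B -> R -> B -> Prop)
  (K1 : A -> Prop) (K2 : B -> Prop) :
  ball_ok bA -> ball_ok bB -> is_compact bA K1 -> is_compact bB K2 ->
  is_compact (prod_ball bA bB) (fun p => K1 (fst p) /\ K2 (snd p)).
Proof.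
  intros [a1 a2 a3] [b1 b2 b3] H1 H2 I O HO Hc.
  assert (Htube : forall x, K1 x -> exists r (l : list I), 0 < r /\
    forall x', bA x r x' -> forall y, K2 y -> exists i, In i l /\ O i (x', y)).
  { intros x Hx.
    set (good (a : B * R * I) := 0 < snd (fst a) /\
      forall q, prod_ball bA bB (x, fst (fst a)) (snd (fst a)) q -> O (snd a) q).
    destruct (H2 (B * R * I)%type (fun a y => bB (fst (fst a)) (snd (fst a)) y /\ good a))
      as [l Hl].
    - intros a. now apply is_open_and.
    - intros y Hy. destruct (Hc (x, y) (conj Hx Hy)) as [i Hi].
      destruct (HO i _ Hi) as [r [Hr H]]. exists (y, r, i). unfold good. simpl. auto.
    - destruct (list_min (fun a r => good a -> r <= snd (fst a)) l) as [r [Hr Hmin]].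
      + intros a r r' Hr Ha Ha'. specialize (Ha Ha'). lra.
      + intros [[y r] i] _. destruct (Rlt_dec 0 r) as [Hr|Hr].
        * exists r; split; [auto|]. simpl. intros; lra.
        * exists 1; split; [lra|]. intros [Hr' _]. simpl in *. lra.
      + exists r, (map snd l). split; auto.
        intros x' Hx' y Hy. destruct (Hl y Hy) as [a [Ha [Hb Hg]]].
        exists (snd a). split; [now apply in_map|]. apply Hg. split; simpl; auto.
        apply (a2 _ r); auto. }
  destruct (H1 (A * R * list I)%type (fun a x => bA (fst (fst a)) (snd (fst a)) x /\
    forall x', bA (fst (fst a)) (snd (fst a)) x' ->
       forall y, K2 y -> exists i, In i (snd a) /\ O i (x', y))) as [l Hl].
  - intros a. now apply is_open_and.
  - intros x Hx. destruct (Htube x Hx) as [r [l [Hr H]]]. exists (x, r, l). simpl. auto.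
  - exists (concat (map snd l)). intros [x y] [Hx Hy]. simpl in *.
    destruct (Hl x Hx) as [a [Ha [Hb H]]]. destruct (H x Hb y Hy) as [i [Hi Hxy]].
    exists i. split; auto. apply in_concat. exists (snd a). split; auto. now apply in_map.
Qed.

Lemma compact_interval c r : is_compact ballR (fun y => Rabs (y - c) <= r).
Proof.
  intros I O HO Hc.
  destruct (Rlt_dec r 0) as [Hr|Hr].
  { exists []. intros y Hy. pose proof (Rabs_pos (y - c)). lra. }
  set (E z := c - r <= z <= c + r /\ exists l : list I,
     forall y, c - r <= y <= z -> exists i, In i l /\ O i y).
  assert (Hcov : forall y, c - r <= y <= c + r -> exists i, O i y).
  { intros y Hy. apply Hc. apply Rabs_le. lra. }
  destruct (completeness E) as [m [Hub Hlub]].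
  - exists (c + r). intros z [Hz _]. lra.
  - exists (c - r). split; [lra|]. destruct (Hcov (c - r)) as [i Hi]; [lra|].
    exists [i]. intros y Hy. exists i. split; [simpl; auto|]. now replace y with (c - r) by lra.
  - assert (Hm : c - r <= m <= c + r).
    { split; [|apply Hlub; intros z [Hz _]; lra]. apply Hub.
      split; [lra|]. destruct (Hcov (c - r)) as [i Hi]; [lra|].
      exists [i]. intros y Hy. exists i. split; [simpl; auto|]. now replace y with (c - r) by lra. }
    destruct (Hcov m Hm) as [i Hi]. destruct (HO i m Hi) as [d [Hd Hball]].
    assert (Hz : exists z, E z /\ m - d < z).
    { apply NNPP. intros Hn. enough (m <= m - d) by lra. apply Hlub.
      intros z Hz. apply Rnot_lt_le. intros Hlt. apply Hn. eauto. }
    destruct Hz as [z [[Hz [l Hl]] Hmz]].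
    (* The set covering the supremum [m] reaches past it, so [m + d / 2] would exceed the supremum
       and the minimum must be [c + r]. *)
    assert (HE : E (Rmin (c + r) (m + d / 2))).
    { split; [split; [apply Rmin_glb; lra|apply Rmin_l]|].
      exists (i :: l). intros y [Hy1 Hy2].
      pose proof (Rmin_r (c + r) (m + d / 2)).
      destruct (Rle_dec y z) as [Hyz|Hyz].
      - destruct (Hl y) as [k [Hk Hy]]; [lra|]. exists k. simpl. auto.
      - exists i. split; [simpl; auto|]. apply Hball. apply Rabs_def1; lra. }
    pose proof (Hub _ HE) as Hle.
    unfold Rmin in *. destruct (Rle_dec (c + r) (m + d / 2)); [|lra].
    destruct HE as [_ [l' Hl']]. exists l'. intros y Hy. apply Hl'.
    apply Rabs_le_bounds in Hy. lra.
Qed.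

Definition box {n} (c : Vec n) (r : R) (v : Vec n) : Prop := forall i, Rabs (v i - c i) <= r.

Lemma compact_box n (c : Vec n) r : is_compact (ballV n) (box c r).
Proof.
  revert c; induction n as [|n IH]; intros c I O HO Hc.
  - assert (H0 : forall v w : Vec 0, v = w).
    { intros v w. apply functional_extensionality. intros i. inversion i. }
    destruct (Hc c) as [i Hi]; [intros i; inversion i|].
    exists [i]. intros v _. exists i. rewrite (H0 v c). simpl. auto.
  - set (cons (p : R * Vec n) := fun i : Fin.t (S n) => Fin.caseS' i (fun _ => R) (fst p) (snd p)).
    assert (Hcons : forall v : Vec (S n), v = cons (v Fin.F1, fun i => v (Fin.FS i))).
    { intros v. apply functional_extensionality. intros i. now apply (Fin.caseS' i). }
    pose proof (compact_prod ballR (ballV n) _ _ ball_ok_R (ball_ok_V n)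
       (compact_interval (c Fin.F1) r) (IH (fun i => c (Fin.FS i)))) as H.
    destruct (H I (fun i p => O i (cons p))) as [l Hl].
    + intros i p Hp. destruct (HO i _ Hp) as [d [Hd Hb]]. exists d. split; auto.
      intros q [Hq1 Hq2]. apply Hb. intros j. apply (Fin.caseS' j); auto.
    + intros p [Hp1 Hp2]. apply Hc. intros j. apply (Fin.caseS' j); auto.
    + exists l. intros v Hv. rewrite (Hcons v). apply Hl. split; [apply Hv|].
      intros j; apply Hv.
Qed.

(** * Continuous real functions on all of R^n *)

Definition contf {n} (f : Vec n -> R) : Prop :=
  forall p e, 0 < e -> exists d, 0 < d /\ forall q, ballV n p d q -> Rabs (f q - f p) < e.

Lemma contf_const {n} c : contf (fun _ : Vec n => c).
Proof.
  intros p e He. exists 1. split; [lra|]. intros. replace (c - c) with 0 by ring.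
  now rewrite Rabs_R0.
Qed.

Lemma contf_coord {n} (i : Fin.t n) : contf (fun v => v i).
Proof. intros p e He. exists e. split; auto. Qed.

Lemma contf_plus {n} (f g : Vec n -> R) : contf f -> contf g -> contf (fun v => f v + g v).
Proof.
  intros Hf Hg p e He.
  destruct (Hf p (e / 2)) as [d1 [Hd1 H1]]; [lra|].
  destruct (Hg p (e / 2)) as [d2 [Hd2 H2]]; [lra|].
  exists (Rmin d1 d2). split; [now apply Rmin_pos|]. intros q Hq.
  specialize (H1 q (ball_mono _ (ball_ok_V n) _ _ _ _ (Rmin_l _ _) Hq)).
  specialize (H2 q (ball_mono _ (ball_ok_V n) _ _ _ _ (Rmin_r _ _) Hq)).
  replace (f q + g q - (f p + g p)) with ((f q - f p) + (g q - g p)) by ring.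
  pose proof (Rabs_triang (f q - f p) (g q - g p)). lra.
Qed.

Lemma contf_comp {n} (h : R -> R) (f : Vec n -> R) :
  (forall p, continuity_pt h (f p)) -> contf f -> contf (fun v => h (f v)).
Proof.
  intros Hh Hf p e He.
  destruct (Hh p e He) as [d1 [Hd1 H1]].
  destruct (Hf p d1 Hd1) as [d [Hd H]].
  exists d. split; auto. intros q Hq. specialize (H q Hq).
  (* [continuity_pt] speaks only of points different from the limit point. *)
  destruct (Req_dec (f q) (f p)) as [Heq|Hneq].
  - rewrite Heq. replace (h (f p) - h (f p)) with 0 by ring. now rewrite Rabs_R0.
  - apply (H1 (f q)). split; [split; [exact I|auto]|exact H].
Qed.

Lemma contf_scal {n} c (f : Vec n -> R) : contf f -> contf (fun v => c * f v).
Proof.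
  apply (contf_comp (fun r => c * r)). intros p. apply derivable_continuous_pt.
  apply derivable_pt_scal, derivable_pt_id.
Qed.

Lemma contf_minus {n} (f g : Vec n -> R) : contf f -> contf g -> contf (fun v => f v - g v).
Proof.
  intros Hf Hg. apply contf_plus; auto. apply (contf_comp Ropp); auto.
  intros p. apply derivable_continuous_pt. apply (derivable_pt_opp id), derivable_pt_id.
Qed.

Lemma contf_abs {n} (f : Vec n -> R) : contf f -> contf (fun v => Rabs (f v)).
Proof. apply (contf_comp Rabs). intros p. apply Rcontinuity_abs. Qed.

Lemma contf_inv {n} (f : Vec n -> R) : (forall v, f v <> 0) -> contf f -> contf (fun v => / f v).
Proof.
  intros H. apply (contf_comp Rinv). intros p.
  apply (continuity_pt_inv id); [apply derivable_continuous_pt, derivable_pt_id|apply H].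
Qed.

(* By polarisation, so that only the continuity of the square is needed. *)
Lemma contf_mult {n} (f g : Vec n -> R) : contf f -> contf g -> contf (fun v => f v * g v).
Proof.
  intros Hf Hg.
  assert (Hs : forall k : Vec n -> R, contf k -> contf (fun v => Rsqr (k v))).
  { intros k. apply (contf_comp Rsqr). intros p. apply derivable_continuous_pt, derivable_pt_Rsqr. }
  replace (fun v => f v * g v) with
    (fun v => / 4 * (Rsqr (f v + g v) - Rsqr (f v - g v))).
  - apply contf_scal, contf_minus; apply Hs; [now apply contf_plus|now apply contf_minus].
  - apply functional_extensionality. intros v. unfold Rsqr. field.
Qed.

Lemma contf_compV {n m} (f : Vec m -> R) (g : Vec n -> Vec m) :
  contf f -> (forall i, contf (fun v => g v i)) -> contf (fun v => f (g v)).
Proof.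
  intros Hf Hg p e He. destruct (Hf (g p) e He) as [d1 [Hd1 H1]].
  destruct (fin_min (fun i d => forall q, ballV n p d q -> Rabs (g q i - g p i) < d1)) as [d [Hd H]].
  - intros i r r' Hr H q Hq. apply H. apply (ball_mono _ (ball_ok_V n) _ r'); [lra|auto].
  - intros i. now apply Hg.
  - exists d. split; auto. intros q Hq. apply H1. intros i. now apply H.
Qed.

Lemma contf_l1 {n} : contf (@l1 n).
Proof.
  unfold l1. induction (fins n) as [|i l IH].
  - apply (contf_const 0).
  - apply (contf_plus (fun v => Rabs (v i)) (fun v => lsum (fun i => Rabs (v i)) l)); auto.
    apply contf_abs, contf_coord.
Qed.

(** * From Tucker's lemma to the Borsuk-Ulam theorem *)

Lemma labelled_notin {T J} (lab : J -> bool -> T -> bool) L x j :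
  (forall j' e, lab j' e x = true -> j' = j) -> ~ In j L -> labelled lab L x = false.
Proof.
  intros H; induction L as [|k L IH]; intros Hj; simpl in *; auto.
  rewrite IH by tauto.
  destruct (lab k true x) eqn:E1; [apply H in E1; subst; tauto|].
  destruct (lab k false x) eqn:E2; [apply H in E2; subst; tauto|]. reflexivity.
Qed.

Lemma labelled_unique {T J} (lab : J -> bool -> T -> bool) L x j e :
  NoDup L -> In j L -> lab j e x = true ->
  (forall j' e', lab j' e' x = true -> j' = j /\ e' = e) -> labelled lab L x = true.
Proof.
  intros HL Hj He H.
  assert (H1 : forall j' e', lab j' e' x = true -> j' = j) by (intros j' e' H'; now destruct (H j' e')).
  induction L as [|k L IH]; [easy|].
  inversion HL as [|? ? Hk HL']; subst. simpl. destruct Hj as [->|Hj].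
  - rewrite (labelled_notin lab L x j) by auto.
    destruct e; rewrite He;
      [destruct (lab j false x) eqn:E|destruct (lab j true x) eqn:E]; auto;
      destruct (H _ _ E); discriminate.
  - rewrite IH by auto.
    destruct (lab k true x) eqn:E1; [apply H1 in E1; subst; tauto|].
    destruct (lab k false x) eqn:E2; [apply H1 in E2; subst; tauto|]. reflexivity.
Qed.

Lemma vneg_l1 {n} (v : Vec n) : l1 (vneg v) = l1 v.
Proof. apply lsum_eq. intros i _. apply Rabs_Ropp. Qed.

Theorem borsuk_ulam {n} (F : Vec n -> Vec n) :
  (forall i, contf (fun v => F v i)) ->
  (forall v, l1 v = 1 -> forall i, F (vneg v) i = - F v i) ->
  exists v, l1 v <= 1 /\ forall i, F v i = 0.
Proof.
  intros HF Hodd. apply NNPP. intros Hno.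
  assert (Hbox : forall v : Vec n, l1 v <= 1 -> box (fun _ => 0) 1 v).
  { intros v Hv i. rewrite Rminus_0_r. pose proof (l1_coord v i). lra. }
  (* Without zeros, some coordinate of [F] is at least [eta] in absolute value throughout the [l1]
     ball. Compactness is that of the box; near points outside the ball the claim is vacuous. *)
  destruct (compact_uniform (ballV n) (box (fun _ => 0) 1)
    (fun v r => l1 v <= 1 -> exists i, r <= Rabs (F v i))) as [eta [Heta Hlow]].
  { apply ball_ok_V. }
  { apply compact_box. }
  { intros v r r' Hr H Hv. destruct (H Hv) as [i Hi]. exists i. lra. }
  { intros v _. destruct (Rle_dec (l1 v) 1) as [Hv|Hv].
    - assert (Hi : exists i, F v i <> 0).
      { apply NNPP. intros Hn. apply Hno. exists v. split; auto.
        intros i. apply NNPP. intros Hi. eauto. }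
      destruct Hi as [i Hi]. pose proof (Rabs_pos_lt _ Hi) as Hp.
      destruct (HF i v (Rabs (F v i) / 2)) as [d [Hd H]]; [lra|].
      exists (Rmin d (Rabs (F v i) / 2)). split; [apply Rmin_pos; lra|].
      intros w Hw _ _. exists i. eapply Rle_trans; [apply Rmin_r|].
      specialize (H w (ball_mono _ (ball_ok_V n) _ _ _ _ (Rmin_l _ _) Hw)).
      pose proof (Rabs_triang_inv (F v i) (F w i)). rewrite Rabs_minus_sym in H. lra.
    - destruct (contf_l1 v (l1 v - 1)) as [d [Hd H]]; [lra|].
      exists d. split; auto. intros w Hw _ Hw1. specialize (H w Hw).
      apply Rabs_def2 in H. lra. }
  destruct (compact_uniform (ballV n) (box (fun _ => 0) 1)
    (fun v r => forall w, ballV n v r w -> forall i, Rabs (F w i - F v i) < eta)) as [d [Hd Huc]].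
  { apply ball_ok_V. }
  { apply compact_box. }
  { intros v r r' Hr H w Hw. apply H. apply (ball_mono _ (ball_ok_V n) _ r'); [lra|auto]. }
  { intros v _.
    destruct (fin_min (fun i d => forall w, ballV n v d w -> Rabs (F w i - F v i) < eta / 2))
      as [d [Hd H]].
    - intros i r r' Hr H w Hw. apply H. apply (ball_mono _ (ball_ok_V n) _ r'); [lra|auto].
    - intros i. apply HF. lra.
    - exists (d / 2). split; [lra|]. intros w Hw _ u Hu i.
      assert (H1 : Rabs (F w i - F v i) < eta / 2).
      { apply H. intros j. specialize (Hw j). lra. }
      assert (H2 : Rabs (F u i - F v i) < eta / 2).
      { apply H. intros j. specialize (Hw j). specialize (Hu j).
        replace (u j - v j) with ((u j - w j) + (w j - v j)) by ring.
        pose proof (Rabs_triang (u j - w j) (w j - v j)). lra. }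
      apply Rabs_def2 in H1. apply Rabs_def2 in H2. apply Rabs_def1; lra. }
  (* A point is labelled by its first coordinate of size at least [eta], with the sign of that
     coordinate. Complementary labels force a jump of at least [2 * eta], which [Huc] forbids for
     close points. *)
  set (big v (i : Fin.t n) := if Rle_dec eta (Rabs (F v i)) then true else false).
  set (pos v (i : Fin.t n) := if Rle_dec 0 (F v i) then true else false).
  set (lab j e v := match find (big v) (fins n) with
    | Some i => if Fin.eq_dec i j then Bool.eqb e (pos v i) else false
    | None => false end).
  assert (Hlab : forall j e v, lab j e v = true ->
     eta <= (if e then 1 else -1) * F v j).
  { intros j e v. unfold lab. destruct (find (big v) (fins n)) as [i|] eqn:E; [|discriminate].
    destruct (Fin.eq_dec i j) as [->|]; [|discriminate].
    apply find_some in E. destruct E as [_ E]. unfold big in E.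
    destruct (Rle_dec eta (Rabs (F v j))) as [Hb|]; [|discriminate].
    unfold pos. destruct (Rle_dec 0 (F v j)) as [Hp|Hp], e; simpl; try discriminate; intros _.
    - rewrite Rabs_right in Hb; lra.
    - rewrite Rabs_left in Hb; lra. }
  apply (tucker lab (d / 2)); [lra| | |].
  - intros v Hv. destruct (find (big v) (fins n)) as [i|] eqn:E.
    + apply (labelled_unique lab _ v i (pos v i)).
      * apply fins_NoDup.
      * apply fins_In.
      * unfold lab. rewrite E. destruct (Fin.eq_dec i i); [apply eqb_reflx|easy].
      * intros j e. unfold lab. rewrite E. destruct (Fin.eq_dec i j) as [->|]; [|discriminate].
        intros H. apply eqb_prop in H. auto.
    + exfalso. destruct (Hlow v (Hbox v Hv) Hv) as [i Hi].
      pose proof (find_none _ _ E i (fins_In n i)) as H. unfold big in H.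
      destruct (Rle_dec eta (Rabs (F v i))); [discriminate|easy].
  - intros v Hv j e. unfold lab.
    replace (big (vneg v)) with (big v).
    + destruct (find (big v) (fins n)) as [i|] eqn:E; auto.
      destruct (Fin.eq_dec i j); auto.
      apply find_some in E. destruct E as [_ E]. unfold big in E.
      destruct (Rle_dec eta (Rabs (F v i))) as [Hb|]; [|discriminate].
      assert (F v i <> 0) by (intros H0; rewrite H0, Rabs_R0 in Hb; lra).
      unfold pos. rewrite Hodd by auto.
      destruct (Rle_dec 0 (F v i)), (Rle_dec 0 (- F v i)), e; auto; lra.
    + apply functional_extensionality. intros i. unfold big. now rewrite Hodd, Rabs_Ropp.
  - intros v w Hv Hw Hvw j.
    destruct (lab j true v) eqn:E1; auto. destruct (lab j false w) eqn:E2; auto.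
    apply Hlab in E1. apply Hlab in E2.
    assert (H : Rabs (F w j - F v j) < eta).
    { apply (Huc v (Hbox v Hv)). intros i. specialize (Hvw i).
      rewrite Rabs_minus_sym. lra. }
    apply Rabs_def2 in H. lra.
Qed.

(** * Stability of values of injective maps *)

Lemma l1_scal {n} (k : R) (v : Vec n) : 0 <= k -> l1 (fun i => k * v i) = k * l1 v.
Proof.
  intros Hk. unfold l1. rewrite <- lsum_scal. apply lsum_eq. intros i _.
  rewrite Rabs_mult, (Rabs_right k); lra.
Qed.

(** Pairs at distance [1] form a compact set off the diagonal, on which injectivity keeps the images
    apart. *)
Lemma injective_separation {n} (f : Vec n -> Vec n) (c : Vec n) :
  (forall i, contf (fun v => f v i)) ->
  (forall p q, box c 1 p -> box c 1 q -> f p = f q -> p = q) ->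
  exists r, 0 < r /\ forall p q, box c 1 p -> box c 1 q -> l1 (fun i => p i - q i) = 1 ->
    exists i, r <= Rabs (f p i - f q i).
Proof.
  intros Hf Hinj.
  destruct (compact_uniform (prod_ball (ballV n) (ballV n))
    (fun a => box c 1 (fst a) /\ box c 1 (snd a))
    (fun a r => l1 (fun i => fst a i - snd a i) = 1 ->
        exists i, r <= Rabs (f (fst a) i - f (snd a) i))) as [r [Hr H]].
  { apply ball_ok_prod; apply ball_ok_V. }
  { apply compact_prod; auto using ball_ok_V, compact_box. }
  { intros a r r' Hr H Ha. destruct (H Ha) as [i Hi]. exists i. lra. }
  { intros [p q] [Hp Hq]. simpl in Hp, Hq.
    destruct (classic (p = q)) as [<-|Hpq].
    - destruct (@contf_l1 n (fun _ => 0) 1) as [d [Hd H]]; [lra|].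
      exists (d / 2). split; [lra|]. intros [p' q'] [Hp' Hq'] _ H1. exfalso. simpl in *.
      specialize (H (fun i => p' i - q' i)). rewrite H1 in H.
      assert (H0 : l1 (fun _ : Fin.t n => 0) = 0).
      { unfold l1. rewrite (lsum_eq _ (fun _ => 0)); [rewrite lsum_const; lra|].
        intros; apply Rabs_R0. }
      rewrite H0 in H. rewrite Rabs_right in H by lra.
      enough (1 - 0 < 1) by lra. apply H. intros i. specialize (Hp' i). specialize (Hq' i).
      apply Rabs_def2 in Hp'. apply Rabs_def2 in Hq'. apply Rabs_def1; lra.
    - assert (Hi : exists i, f p i <> f q i).
      { apply NNPP. intros Hn. apply Hpq. apply Hinj; auto.
        apply functional_extensionality. intros i. apply NNPP. eauto. }
      destruct Hi as [i Hi].
      assert (Hpos : 0 < Rabs (f p i - f q i)) by (apply Rabs_pos_lt; lra).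
      set (e := Rabs (f p i - f q i) / 4).
      destruct (Hf i p e) as [d1 [Hd1 H1]]; [unfold e; lra|].
      destruct (Hf i q e) as [d2 [Hd2 H2]]; [unfold e; lra|].
      exists (Rmin e (Rmin d1 d2)). split; [repeat apply Rmin_pos; auto; unfold e; lra|].
      intros [p' q'] [Hp' Hq'] _ _. simpl in *. exists i.
      eapply Rle_trans; [apply Rmin_l|].
      specialize (H1 p' (ball_mono _ (ball_ok_V n) _ _ _ _
        (Rle_trans _ _ _ (Rmin_r _ _) (Rmin_l _ _)) Hp')).
      specialize (H2 q' (ball_mono _ (ball_ok_V n) _ _ _ _
        (Rle_trans _ _ _ (Rmin_r _ _) (Rmin_r _ _)) Hq')).
      apply Rabs_def2 in H1. apply Rabs_def2 in H2. unfold e in *. clear e.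
      revert H1 H2 Hpos. unfold Rabs.
      destruct (Rcase_abs (f p i - f q i)), (Rcase_abs (f p' i - f q' i)); intros; lra. }
  exists r. split; auto. intros p q Hp Hq. apply (H (p, q)). split; auto.
Qed.

(* The map given to [borsuk_ulam] is [ft (c + 2 v) - y] for [l1 v <= 1/2]; at radius
   [l1 v = m >= 1/2], with [t = 2 m - 1] running from [0] to [1], it compares [ft] at
   [c + u] and [c - t u] for [u = v / (2 m^2)], two points at [l1]-distance [1]. *)
Lemma injective_stable {n} (f : Vec n -> Vec n) (c : Vec n) :
  (forall i, contf (fun v => f v i)) ->
  (forall p q, box c 1 p -> box c 1 q -> f p = f q -> p = q) ->
  exists mu, 0 < mu /\ forall ft : Vec n -> Vec n,
    (forall i, contf (fun v => ft v i)) ->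
    (forall p, box c 1 p -> forall i, Rabs (ft p i - f p i) < mu) ->
    forall y, (forall i, Rabs (y i - f c i) < mu) -> exists p, box c 1 p /\ ft p = y.
Proof.
  intros Hf Hinj. destruct (injective_separation f c Hf Hinj) as [r [Hr Hsep]].
  (* Four errors enter the final comparison: [ft] against [f] at two separated points and at [c],
     and [y] against [f c]. *)
  exists (r / 4). split; [lra|]. intros ft Hft Hclose y Hy.
  (* [m v] is the maximum of [l1 v] and [/ 2], written so that continuity is immediate. On the inner
     half this gives [t v = 0], [k v = 2] and [B v = c]. *)
  set (m (v : Vec n) := / 2 * (l1 v + / 2 + Rabs (l1 v - / 2))).
  set (k v := / (2 * (m v * m v))).
  set (t v := 2 * m v - 1).
  set (A v := fun i => c i + k v * v i).
  set (B v := fun i => c i - t v * (k v * v i)).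
  assert (Hm1 : forall v, l1 v <= / 2 -> m v = / 2).
  { intros v Hv. unfold m. rewrite Rabs_left1; lra. }
  assert (Hm2 : forall v, / 2 <= l1 v -> m v = l1 v).
  { intros v Hv. unfold m. rewrite Rabs_right; lra. }
  assert (Hm : forall v, / 2 <= m v).
  { intros v. destruct (Rle_dec (l1 v) (/ 2)) as [H|H]; [rewrite Hm1|rewrite Hm2]; lra. }
  assert (Hk : forall v, 0 < k v).
  { intros v. specialize (Hm v). apply Rinv_0_lt_compat. nra. }
  assert (Hcm : contf m).
  { apply contf_scal. apply contf_plus.
    - apply contf_plus; [apply contf_l1|apply contf_const].
    - apply contf_abs, contf_minus; [apply contf_l1|apply contf_const]. }
  assert (Hck : contf k).
  { apply contf_inv.
    - intros v. specialize (Hm v). nra.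
    - apply contf_scal, contf_mult; auto. }
  assert (Hct : contf t).
  { apply contf_minus; [now apply contf_scal|apply contf_const]. }
  assert (HcA : forall i, contf (fun v => A v i)).
  { intros i. apply contf_plus; [apply contf_const|]. apply contf_mult; auto using contf_coord. }
  assert (HcB : forall i, contf (fun v => B v i)).
  { intros i. apply contf_minus; [apply contf_const|]. apply contf_mult; auto.
    apply contf_mult; auto using contf_coord. }
  destruct (borsuk_ulam (fun v i => ft (A v) i - ft (B v) i - (1 - t v) * (y i - ft c i)))
    as [v [Hv HF]].
  - intros i. apply contf_minus; [apply contf_minus|].
    + now apply (contf_compV (fun w => ft w i)).
    + now apply (contf_compV (fun w => ft w i)).
    + apply contf_mult; [|apply contf_const]. apply contf_minus; auto using contf_const.
  - intros v Hv i.
    (* On the boundary the antipode exchanges [A] and [B], and the factor [1 - t v] removes the term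
       that is not odd. *)
    assert (Ht1 : t v = 1) by (unfold t; rewrite Hm2; lra).
    assert (HAB : A (vneg v) = B v).
    { apply functional_extensionality. intros j. unfold A, B. rewrite Ht1.
      unfold k. rewrite !Hm2 by (rewrite ?vneg_l1; lra). rewrite vneg_l1. unfold vneg. ring. }
    assert (HBA : B (vneg v) = A v).
    { apply functional_extensionality. intros j. unfold A, B, t, k.
      rewrite !Hm2 by (rewrite ?vneg_l1; lra). rewrite vneg_l1, Hv. unfold vneg. ring. }
    rewrite HAB, HBA.
    replace (t (vneg v)) with 1 by (unfold t; rewrite Hm2; rewrite vneg_l1; lra).
    rewrite Ht1. ring.
  - assert (Ht : 0 <= t v <= 1).
    { unfold t. pose proof (Hm v) as Hmv. split; [lra|].
      destruct (Rle_dec (l1 v) (/ 2)) as [Hl|Hl]; [rewrite Hm1|rewrite Hm2]; lra. }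
    assert (Hkl : k v * l1 v <= 1).
    { specialize (Hm v). unfold k. apply Rmult_le_reg_l with (2 * (m v * m v)); [nra|].
      rewrite <- Rmult_assoc, Rinv_r by nra.
      destruct (Rle_dec (l1 v) (/ 2)) as [Hl|Hl]; [rewrite (Hm1 v) by lra|rewrite (Hm2 v) by lra];
      nra. }
    assert (Hkv : forall i, Rabs (k v * v i) <= 1).
    { intros i. rewrite Rabs_mult, (Rabs_right (k v)) by (specialize (Hk v); lra).
      eapply Rle_trans; [|exact Hkl]. apply Rmult_le_compat_l; [specialize (Hk v); lra|].
      apply l1_coord. }
    assert (HA : box c 1 (A v)).
    { intros i. unfold A. replace (c i + k v * v i - c i) with (k v * v i) by ring. apply Hkv. }
    assert (HB : box c 1 (B v)).
    { intros i. unfold B. replace (c i - t v * (k v * v i) - c i) with (- (t v * (k v * v i))) by ring.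
      rewrite Rabs_Ropp, Rabs_mult, (Rabs_right (t v)) by lra.
      specialize (Hkv i). pose proof (Rabs_pos (k v * v i)). nra. }
    (* A zero in the inner half is the wanted preimage; one in the outer half contradicts the
       separation of [A v] and [B v]. *)
    destruct (Rle_dec (l1 v) (/ 2)) as [Hl|Hl].
    + exists (A v). split; auto. apply functional_extensionality. intros i.
      specialize (HF i). cbv beta in HF.
      assert (Ht0 : t v = 0) by (unfold t; rewrite Hm1; lra).
      replace (B v) with c in HF.
      * rewrite Ht0 in HF. lra.
      * apply functional_extensionality. intros j. unfold B. rewrite Ht0. ring.
    + exfalso.
      destruct (Hsep (A v) (B v) HA HB) as [i Hi].
      { replace (fun i => A v i - B v i) with (fun i => ((1 + t v) * k v) * v i).
        - rewrite l1_scal.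
          + unfold k, t. rewrite Hm2 by lra. field. lra.
          + specialize (Hk v). nra.
        - apply functional_extensionality. intros i. unfold A, B. ring. }
      specialize (HF i). cbv beta in HF.
      pose proof (Rabs_def2 _ _ (Hclose _ HA i)). pose proof (Rabs_def2 _ _ (Hclose _ HB i)).
      assert (Hc : box c 1 c).
      { intros j. replace (c j - c j) with 0 by ring. rewrite Rabs_R0. lra. }
      pose proof (Rabs_def2 _ _ (Hclose _ Hc i)). pose proof (Rabs_def2 _ _ (Hy i)).
      assert (Hd : Rabs ((1 - t v) * (y i - ft c i)) < r / 2).
      { rewrite Rabs_mult, (Rabs_right (1 - t v)) by lra.
        assert (Rabs (y i - ft c i) < r / 2) by (apply Rabs_def1; lra).
        pose proof (Rabs_pos (y i - ft c i)). nra. }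
      apply Rabs_def2 in Hd. revert Hi. unfold Rabs. destruct Rcase_abs; intros; lra.
Qed.

(** * From slices to the theorem *)

Lemma continuous_slice {n} (a b : option R) (f : Om n -> R) (U : R) :
  inI a b U -> continuous_on (ballO n) ballR (inOm a b) f -> contf (fun v => f (U, v)).
Proof.
  intros HU Hf p e He. destruct (Hf (U, p) HU e He) as [d [Hd H]].
  exists d. split; auto. intros q Hq. apply (H (U, q)); auto.
  split; auto. simpl. now apply (ball_center _ ball_ok_R).
Qed.

Lemma continuous_on_coord {n} (a b : option R) (f : Om n -> Vec n) (i : Fin.t n) :
  continuous_on (ballO n) (ballV n) (inOm a b) f ->
  continuous_on (ballO n) ballR (inOm a b) (fun p => f p i).
Proof.
  intros Hf p Hp e He. destruct (Hf p Hp e He) as [d [Hd H]].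
  exists d. split; auto. intros q Hq Hb. now apply H.
Qed.

Lemma is_open_box {n} (u0 : R) (c : Vec n) (v0 r1 r2 r3 : R) :
  is_open (ballL n) (fun z => Rabs (fst (fst z) - u0) < r1 /\
    (forall i, Rabs (snd (fst z) i - c i) < r2) /\ Rabs (snd z - v0) < r3).
Proof.
  intros [[U X] V]. simpl. intros [H1 [H2 H3]].
  destruct (ball_open _ ball_ok_R u0 r1 U H1) as [s1 [Hs1 K1]].
  destruct (ball_open _ (ball_ok_V n) c r2 X H2) as [s2 [Hs2 K2]].
  destruct (ball_open _ ball_ok_R v0 r3 V H3) as [s3 [Hs3 K3]].
  exists (Rmin s1 (Rmin s2 s3)). split; [now repeat apply Rmin_pos|].
  pose proof (Rmin_l s1 (Rmin s2 s3)). pose proof (Rmin_r s1 (Rmin s2 s3)).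
  pose proof (Rmin_l s2 s3). pose proof (Rmin_r s2 s3).
  intros [[U' X'] V'] [[Hb1 Hb2] Hb3]. simpl in *. split; [|split].
  - apply K1. apply (ball_mono _ ball_ok_R _ (Rmin s1 (Rmin s2 s3))); auto.
  - apply K2. apply (ball_mono _ (ball_ok_V n) _ (Rmin s1 (Rmin s2 s3))); auto. lra.
  - apply K3. apply (ball_mono _ ball_ok_R _ (Rmin s1 (Rmin s2 s3))); auto. lra.
Qed.

(** Writing the bound as [/ r] makes boundedness a property of the kind treated by
    [compact_uniform]. *)
Lemma continuous_bounded {n} (a b : option R) (K : Om n -> Prop) (f : Om n -> R) :
  is_compact (ballO n) K -> (forall p, K p -> inOm a b p) ->
  continuous_on (ballO n) ballR (inOm a b) f ->
  exists M, forall p, K p -> Rabs (f p) <= M.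
Proof.
  intros HK Hin Hf.
  destruct (compact_uniform (ballO n) K (fun p r => Rabs (f p) <= / r)) as [r [Hr H]]; eauto.
  - apply ball_ok_O.
  - intros p r r' Hr H. eapply Rle_trans; [exact H|]. apply Rinv_le_contravar; lra.
  - intros p Hp. destruct (Hf p (Hin p Hp) 1) as [d [Hd H]]; [lra|].
    pose proof (Rabs_pos (f p)) as H0.
    exists (Rmin d (/ (Rabs (f p) + 1))).
    assert (Hi : 0 < / (Rabs (f p) + 1)) by (apply Rinv_0_lt_compat; lra).
    split; [now apply Rmin_pos|]. intros q Hq HKq.
    specialize (H q (Hin q HKq) (ball_mono _ (ball_ok_O n) _ _ _ _ (Rmin_l _ _) Hq)).
    unfold ballR in H. apply Rle_trans with (Rabs (f p) + 1).
    + pose proof (Rabs_triang_inv (f q) (f p)). lra.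
    + pose proof (Rinv_le_contravar _ _ (Rmin_pos d _ Hd Hi) (Rmin_r d _)) as Hle.
      now rewrite Rinv_inv in Hle.
Qed.

Theorem theorem8p2
  (n : nat) (a b : option R)
  (x_ : R -> Om n -> Vec n) (g_ h_ : R -> Om n -> R)
  (x : Om n -> Vec n) (g : Om n -> R) (W : Om n -> Prop) :
  (1 <= n)%nat ->
  ext_pos a -> ext_pos b ->
  (* (1) *)
  (forall eps, 0 < eps <= 1 ->
     smoothV (inOm a b) (x_ eps) /\ smooth (inOm a b) (g_ eps) /\
     smooth (inOm a b) (h_ eps)) ->
  propE n a b (fun eps => tmap (x_ eps) (g_ eps) (h_ eps)) ->
  (forall K : Om n -> Prop, is_compact (ballO n) K -> (forall p, K p -> inOm a b p) ->
     exists M eps1, 0 < eps1 <= 1 /\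
       forall eps, 0 < eps <= eps1 -> forall p, K p -> Rabs (h_ eps p) <= M) ->
  (* (2) *)
  propE n a b (fun eps => smap (x_ eps) (g_ eps)) ->
  (* (3) *)
  continuous_on (ballO n) (ballV n) (inOm a b) x ->
  continuous_on (ballO n) ballR (inOm a b) g ->
  is_open (ballO n) W ->
  (forall p, W p -> inOm a b p) ->
  (forall p : Om n, gt_lb a (fst p) -> fst p <= 0 -> W p) ->
  (forall p q, W p -> W q -> (fst p, x p) = (fst q, x q) -> p = q) ->
  (* (4) *)
  (forall K : Lam n -> Prop, is_compact (ballL n) K -> (forall p, K p -> inLam a b p) ->
     forall e, 0 < e -> exists d, 0 < d /\
       forall eps, 0 < eps <= 1 -> eps < d ->
         forall p, K p -> ballL n (smap x g p) e (smap (x_ eps) (g_ eps) p)) ->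
  (* conclusion *)
  forall p : Lam n, inLam a b p -> fst (fst p) = 0 ->
    exists P : Lam n -> Prop,
      is_open (ballL n) P /\ P p /\ (forall z, P z -> W (fst z)) /\
    exists Q : Lam n -> Prop,
      is_open (ballL n) Q /\ Q (smap x g p) /\
      (forall y, Q y -> exists z, W (fst z) /\ smap x g z = y) /\
    exists eps0, 0 < eps0 <= 1 /\
      forall eps, 0 < eps <= eps0 ->
        forall y, clos (ballL n) Q y ->
          exists z, P z /\ tmap (x_ eps) (g_ eps) (h_ eps) z = y.
Proof.
  intros _ Ha _ Hsm _ Hh _ Hx Hg HW HWin HW0 Hinj Hconv [[U0 c] v0] Hp HU0.
  simpl in HU0. subst U0.
  assert (Ha0 : gt_lb a 0) by (destruct a; simpl in *; lra).
  assert (HW0c : forall X : Vec n, W (0, X)) by (intros X; apply HW0; simpl; auto; lra).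
  assert (Hin0 : inI a b 0) by (apply (HWin (0, c)); auto).
  (* The reference map is the slice at [U = 0], which lies in [W] and is therefore injective; nearby
     slices of [x] and of [x_ eps] are treated as perturbations of it. *)
  destruct (injective_stable (fun X => x (0, X)) c) as [mu [Hmu Hst]].
  { intros i. apply (continuous_slice a b (fun p => x p i)); auto using continuous_on_coord. }
  { intros X Y _ _ HXY. assert (H : (0, X) = (0, Y)) by (apply Hinj; auto; simpl; congruence).
    now injection H. }
  (* Preimages will lie in the closed box of radius [1]; radius [2] leaves room for the open set
     [P]. Half of [mu] is kept for passing from [x] to [x_ eps]. *)
  destruct (compact_uniform (ballV n) (box c 2)
    (fun X r => forall U, Rabs U <= r -> W (U, X) /\
       forall i, Rabs (x (U, X) i - x (0, X) i) < mu / 2)) as [rho [Hrho Hloc]].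
  { apply ball_ok_V. }
  { apply compact_box. }
  { intros X r r' Hr H U HU. apply H. lra. }
  { intros X _. destruct (HW (0, X) (HW0c X)) as [r1 [Hr1 H1]].
    destruct (Hx (0, X) Hin0 (mu / 4)) as [r2 [Hr2 H2]]; [lra|].
    pose proof (Rmin_l r1 r2). pose proof (Rmin_r r1 r2). pose proof (Rmin_pos r1 r2 Hr1 Hr2).
    exists (Rmin r1 r2 / 2). split; [lra|]. intros Y HY _ U HU.
    assert (HUY : W (U, Y)).
    { apply H1. split; simpl.
      - unfold ballR. rewrite Rminus_0_r. lra.
      - intros i. specialize (HY i). lra. }
    split; auto. intros i.
    assert (K1 : Rabs (x (U, Y) i - x (0, X) i) < mu / 4).
    { apply (H2 (U, Y)); [now apply HWin|]. split; simpl.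
      - unfold ballR. rewrite Rminus_0_r. lra.
      - intros j. specialize (HY j). lra. }
    assert (K2 : Rabs (x (0, Y) i - x (0, X) i) < mu / 4).
    { apply (H2 (0, Y)); [exact Hin0|]. split; simpl.
      - unfold ballR. rewrite Rminus_0_r, Rabs_R0. lra.
      - intros j. specialize (HY j). lra. }
    apply Rabs_def2 in K1. apply Rabs_def2 in K2. apply Rabs_def1; lra. }
  assert (H12 : forall X : Vec n, box c 1 X -> box c 2 X) by (intros X H i; specialize (H i); lra).
  assert (Hrange : forall U X, Rabs U <= rho -> box c 2 X -> inI a b U).
  { intros U X HU HX. apply (HWin (U, X)). now apply Hloc. }
  assert (Hcc : box c 2 c).
  { intros i. replace (c i - c i) with 0 by ring. rewrite Rabs_R0. lra. }
  set (K := fun q : Om n => Rabs (fst q - 0) <= rho /\ box c 2 (snd q)).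
  assert (HK : is_compact (ballO n) K).
  { apply (compact_prod ballR (ballV n) (fun y => Rabs (y - 0) <= rho) (box c 2));
      auto using ball_ok_R, ball_ok_V, compact_interval, compact_box. }
  assert (HKin : forall q, K q -> inOm a b q).
  { intros [U X] [HU HX]. simpl in *. rewrite Rminus_0_r in HU. now apply (Hrange U X). }
  destruct (Hh K HK HKin) as [Mh [eps1 [Heps1 HMh]]].
  destruct (continuous_bounded a b K g HK HKin Hg) as [Mg HMg].
  (* At [V = 0] the last coordinates of the two maps are [g] and [g_ eps]. *)
  destruct (Hconv (fun q => K (fst q) /\ Rabs (snd q - 0) <= 0)) with (e := Rmin (mu / 2) 1)
    as [d [Hd Hcl]].
  { apply (compact_prod (ballO n) ballR K (fun y => Rabs (y - 0) <= 0));
      auto using ball_ok_R, ball_ok_O, compact_interval. }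
  { intros q [Hq _]. now apply HKin. }
  { apply Rmin_pos; lra. }
  assert (Hclose : forall eps, 0 < eps <= 1 -> eps < d -> forall U X, Rabs U <= rho -> box c 2 X ->
     (forall i, Rabs (x_ eps (U, X) i - x (U, X) i) < mu / 2) /\
     Rabs (g_ eps (U, X) - g (U, X)) < 1).
  { intros eps He Hed U X HU HX.
    destruct (Hcl eps He Hed (U, X, 0)) as [[_ H1] H2].
    - repeat split; simpl; auto; rewrite Rminus_0_r; auto. rewrite Rabs_R0. lra.
    - simpl in *. unfold ballR in H2. split.
      + intros i. specialize (H1 i). pose proof (Rmin_l (mu / 2) 1). lra.
      + replace (g_ eps (U, X) - g (U, X)) with (0 + g_ eps (U, X) - (0 + g (U, X))) by ring.
        pose proof (Rmin_r (mu / 2) 1). lra. }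
  (* Height of [P]: the preimage of a point with last coordinate [V] has last coordinate
     [V - g_ eps - h_ eps]. The [3] is [2] for [V] against [v0 + g (0, c)] plus [1] for [g_ eps]
     against [g]. *)
  set (M := Rabs (g (0, c)) + Mg + Mh + 3).
  exists (fun z => Rabs (fst (fst z) - 0) < rho /\
    (forall i, Rabs (snd (fst z) i - c i) < 2) /\ Rabs (snd z - v0) < M).
  assert (HMh0 : 0 <= Mh).
  { eapply Rle_trans; [apply Rabs_pos|apply (HMh eps1) with (p := (0, c)); [lra|]].
    split; simpl; auto. rewrite Rminus_0_r, Rabs_R0. lra. }
  assert (HMg0 : 0 <= Mg).
  { eapply Rle_trans; [apply Rabs_pos|apply (HMg (0, c))].
    split; simpl; auto. rewrite Rminus_0_r, Rabs_R0. lra. }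
  pose proof (Rabs_pos (g (0, c))) as Hg0.
  split; [apply is_open_box|]. split.
  { simpl. rewrite !Rminus_diag, Rabs_R0. split; [lra|]. split; [|unfold M; lra].
    intros i. rewrite Rminus_diag, Rabs_R0. lra. }
  split.
  { intros [[U X] V] [HU [HX _]]. simpl in *. rewrite Rminus_0_r in HU.
    apply Hloc; [|lra]. intros i. specialize (HX i). lra. }
  (* [Q] has half the admissible size, so that its closure still satisfies the strict bounds [rho],
     [mu] and [2]. *)
  exists (fun z => Rabs (fst (fst z) - 0) < rho / 2 /\
    (forall i, Rabs (snd (fst z) i - x (0, c) i) < mu / 2) /\ Rabs (snd z - (v0 + g (0, c))) < 1).
  split; [apply is_open_box|]. split.
  { simpl. rewrite !Rminus_diag, Rabs_R0. split; [lra|]. split; [|lra].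
    intros i. rewrite Rminus_diag, Rabs_R0. lra. }
  split.
  { intros [[U Y] V] [HU [HY _]]. simpl in *. rewrite Rminus_0_r in HU.
    assert (HUin : inI a b U) by (apply (Hrange U c); auto; lra).
    (* Stability applied to the slice of [x] itself gives surjectivity of [s] onto [Q]. *)
    destruct (Hst (fun X => x (U, X))) with (y := Y) as [X [HX HXY]].
    - intros i. apply (continuous_slice a b (fun p => x p i)); auto using continuous_on_coord.
    - intros X HX i. eapply Rlt_trans; [apply Hloc; auto; lra|lra].
    - intros i. specialize (HY i). lra.
    - exists (U, X, V - g (U, X)). split.
      + apply Hloc; auto; lra.
      + simpl. rewrite HXY. f_equal. ring. }
  (* The half makes [eps < d] strict. *)
  exists (Rmin eps1 (d / 2)).
  pose proof (Rmin_l eps1 (d / 2)). pose proof (Rmin_r eps1 (d / 2)).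
  split; [split; [apply Rmin_pos|]; lra|].
  intros eps Heps [[U Y] V] Hcly.
  assert (HQ : Rabs U < rho /\ (forall i, Rabs (Y i - x (0, c) i) < mu) /\
     Rabs (V - (v0 + g (0, c))) < 2).
  { destruct (Hcly (Rmin (rho / 2) (Rmin (mu / 2) 1))) as [[[U' Y'] V'] [[H1 [H2 H3]] [[H4 H5] H6]]].
    - repeat apply Rmin_pos; lra.
    - simpl in *. unfold ballR in *.
      pose proof (Rmin_l (rho / 2) (Rmin (mu / 2) 1)).
      pose proof (Rmin_r (rho / 2) (Rmin (mu / 2) 1)).
      pose proof (Rmin_l (mu / 2) 1). pose proof (Rmin_r (mu / 2) 1).
      apply Rabs_def2 in H1. apply Rabs_def2 in H3. apply Rabs_def2 in H4. apply Rabs_def2 in H6.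
      split; [apply Rabs_def1; lra|]. split; [|apply Rabs_def1; lra].
      intros i. specialize (H2 i). specialize (H5 i). simpl in H5.
      apply Rabs_def2 in H2. apply Rabs_def2 in H5. apply Rabs_def1; lra. }
  destruct HQ as [HU' [HY HV]]. pose proof (Rlt_le _ _ HU') as HU.
  assert (HUin : inI a b U) by (apply (Hrange U c); auto).
  assert (He1 : 0 < eps <= 1) by lra. assert (Hed : eps < d) by lra.
  destruct (Hst (fun X => x_ eps (U, X))) with (y := Y) as [X [HX HXY]]; auto.
  - intros i. apply (continuous_slice a b (fun p => x_ eps p i)); auto.
    (* Smoothness of order zero is continuity. *)
    destruct (Hsm eps He1) as [Hs _]. exact (Hs i O).
  - intros X HX i.
    pose proof (Rabs_def2 _ _ (proj1 (Hclose eps He1 Hed U X HU (H12 X HX)) i)) as K1.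
    pose proof (Rabs_def2 _ _ (proj2 (Hloc X (H12 X HX) U HU) i)) as K2.
    apply Rabs_def1; lra.
  - exists (U, X, V - g_ eps (U, X) - h_ eps (U, X)). split.
    + simpl. rewrite Rminus_0_r. split; auto. split.
      * intros i. specialize (HX i). lra.
      * assert (HKU : K (U, X)).
        { split; simpl; auto. now rewrite Rminus_0_r. }
        pose proof (Rabs_le_bounds _ _ (HMh eps ltac:(lra) _ HKU)).
        pose proof (Rabs_le_bounds _ _ (HMg _ HKU)).
        pose proof (Rabs_def2 _ _ (proj2 (Hclose eps He1 Hed U X HU (H12 X HX)))).
        pose proof (Rabs_le_bounds _ _ (Rle_refl (Rabs (g (0, c))))).
        apply Rabs_def2 in HV. unfold M. apply Rabs_def1; lra.
    + simpl. rewrite HXY. f_equal. ring.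
Qed.
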